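(* Let $\mathcal{E}$ and $\mathcal{V}$ be vector bundles of respective ranks $r$ and $k$ on a scheme $S$. Let $\mathbf{q}\colon\mathcal{V}\to\mathrm{Sym}^2\mathcal{E}^\vee$ be a family of quadratic forms on $\mathcal{E}$ with values in $\mathcal{V}^\vee$. Assume that there exist a double Cartier divisor $D=2E$ and a line subbundle $\mathcal{K}\subset\mathcal{E}|_D$ on $D$ which is contained in the kernel of $\mathbf{q}|_D$. Let $\tilde{\mathbf{q}}\colon\mathcal{V}\to\mathrm{Sym}^2\widetilde{\mathcal{E}}^\vee$ be the Hecke transform of $\mathbf{q}$ with respect to $\mathcal{K}$. (a) The restriction to $E$ of the exact sequence $0\to\mathcal{E}\to\widetilde{\mathcal{E}}\to\mathcal{K}_E(E)\to0$ splits and gives a canonical direct sum decomposition $$\widetilde{\mathcal{E}}_E\cong(\mathcal{E}_E/\mathcal{K}_E)\oplus\mathcal{K}_E(E)$$ of the restriction $\widetilde{\mathcal{E}}_E$ of $\widetilde{\mathcal{E}}$ to $E$. (b) The summands of this decomposition are mutually orthogonal with respect to $\tilde{\mathbf{q}}|_E$. Moreover, the restriction of $\tilde{\mathbf{q}}|_E$ to the first summand is induced by $\mathbf{q}|_E$, and the restriction of $\tilde{\mathbf{q}}|_E$ to the second summand is the residual family of quadratic forms for $\mathbf{q}$ (restricted to $E$).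
   Context: All schemes are over a fixed field $\mathbf{k}$ of characteristic zero. An effective Cartier divisor $D$ is double if $D=2E$ for an effective Cartier divisor $E$, i.e. the ideal of $D$ is the square of the ideal of $E$. A subscript $E$ or $D$ denotes restriction to $E$ or $D$. ''$\mathcal{K}$ is contained in the kernel of $\mathbf{q}|_D$'' means that the composition $\mathcal{V}|_D\to\mathrm{Sym}^2(\mathcal{E}^\vee|_D)\to\mathcal{E}^\vee|_D\otimes\mathcal{K}^\vee$ vanishes. Hecke transform: $\widetilde{\mathcal{E}}$ is the vector bundle whose dual is the kernel of the natural epimorphism $\mathcal{E}^\vee\to\mathcal{K}^\vee_E$, so that there are exact sequences $0\to\widetilde{\mathcal{E}}^\vee\to\mathcal{E}^\vee\to\mathcal{K}_E^\vee\to0$ and, dually, $0\to\mathcal{E}\to\widetilde{\mathcal{E}}\to\mathcal{K}_E(E)\to0$, where $\mathcal{K}_E(E)=\mathcal{K}_E\otimes\mathcal{O}_S(E)$. The Hecke transform of $\mathbf{q}$ with respect to $\mathcal{K}$ is the unique morphism $\tilde{\mathbf{q}}\colon\mathcal{V}\to\mathrm{Sym}^2\widetilde{\mathcal{E}}^\vee$ whose composition with $\mathrm{Sym}^2\widetilde{\mathcal{E}}^\vee\to\mathrm{Sym}^2\mathcal{E}^\vee$ is $\mathbf{q}$. Residual family: locally on $S$, let $\widetilde{\mathcal{K}}\subset\mathcal{E}$ be a line subbundle extending $\mathcal{K}\subset\mathcal{E}|_D$. The composition $\mathcal{V}\to\mathrm{Sym}^2\mathcal{E}^\vee\to\mathrm{Sym}^2\widetilde{\mathcal{K}}^\vee$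 vanishes on $D$, hence factors through $\mathcal{V}(D)\to\mathrm{Sym}^2\widetilde{\mathcal{K}}^\vee$. Its restriction to $D$, $\mathcal{V}(D)|_D\to\mathrm{Sym}^2\mathcal{K}^\vee$, is the residual family; it is independent of the choice of $\widetilde{\mathcal{K}}$. Restricting to $E$ and using $D=2E$, it can be viewed as a morphism $\mathcal{V}|_E\to\mathrm{Sym}^2(\mathcal{K}_E(E))^\vee$. *)

(* Defs.v *)
From HB Require Import structures.
From mathcomp Require Import all_boot all_order all_algebra.
From mathcomp Require Import boolp classical_sets topology.

Set Implicit Arguments.
Unset Strict Implicit.
Unset Printing Implicit Defensive.

Import GRing.Theory.
Local Open Scope classical_set_scope.
Local Open Scope quotient_scope.
Local Open Scope ring_scope.

Record submod (R : pzRingType) (M : lmodType R) := Submod {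
  smem : {pred M};
  smem_closed : submod_closed smem }.
Coercion smem : submod >-> pred_sort.

Section Submod.
Variables (R : pzRingType) (M : lmodType R) (N : submod M).

Let N0 : 0 \in N. Proof. by case: (smem_closed N). Qed.
Let NP a x y : x \in N -> y \in N -> a *: x + y \in N.
Proof. by move=> Nx Ny; case: (smem_closed N) => _; apply. Qed.

Lemma smem_zmod : zmod_closed (smem N).
Proof.
by split=> // x y Nx Ny; rewrite addrC -scaleN1r; apply: NP.
Qed.
HB.instance Definition _ := GRing.isZmodClosed.Build M (smem N) smem_zmod.

Lemma smem_scale : GRing.scaler_closed (smem N).
Proof. by move=> a x Nx; rewrite -[_ *: _]addr0; apply: NP. Qed.
HB.instance Definition _ := GRing.isScaleClosed.Build R M (smem N) smem_scale.

Record subm := Subm { sval_ : M; svalP_ : sval_ \in N }.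
HB.instance Definition _ := [isSub for sval_].
HB.instance Definition _ := [Choice of subm by <:].
HB.instance Definition _ := [SubChoice_isSubLmodule of subm by <:].

Definition smemZ : zmodClosed M := GRing.ZmodClosed.clone M (smem N) _.
Definition quotm := Quotient.quot smemZ.
HB.instance Definition _ := GRing.Zmodule.on quotm.
Definition cls (x : M) : quotm := \pi_quotm x.
Definition rep (x : quotm) : M := repr x.

Lemma repK x : cls (rep x) = x. Proof. exact: reprK. Qed.
Lemma cls_eq x y : (cls x = cls y) <-> x - y \in N.
Proof.
rewrite /cls; split=> [e|e]; first by have := Quotient.idealrBE smemZ x y; rewrite e eqxx.
by apply/eqP; rewrite -Quotient.idealrBE.
Qed.
Lemma clsB x y : cls (x - y) = cls x - cls y.
Proof. by rewrite /cls !piE. Qed.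
Lemma clsD x y : cls (x + y) = cls x + cls y.
Proof. by rewrite /cls !piE. Qed.

Definition qscale (a : R) (x : quotm) : quotm := cls (a *: rep x).
Lemma qscale_cls a x : qscale a (cls x) = cls (a *: x).
Proof.
rewrite /qscale; apply/cls_eq; rewrite -scalerBr.
by apply: smem_scale; apply/cls_eq; rewrite repK.
Qed.
Lemma qscaleA a b v : qscale a (qscale b v) = qscale (a * b) v.
Proof. by rewrite -[v]repK !qscale_cls scalerA. Qed.
Lemma qscale1 : left_id 1 qscale.
Proof. by move=> v; rewrite -[v]repK !qscale_cls scale1r. Qed.
Lemma qscaleDr : right_distributive qscale +%R.
Proof.
by move=> a u v; rewrite -[u]repK -[v]repK -clsD !qscale_cls -clsD scalerDr.
Qed.
Lemma qscaleDl v : {morph qscale^~ v : a b / a + b}.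
Proof. by move=> a b; rewrite -[v]repK !qscale_cls -clsD scalerDl. Qed.
HB.instance Definition _ := GRing.Zmodule_isLmodule.Build R quotm
  qscaleA qscale1 qscaleDr qscaleDl.
Lemma cls_linear : linear cls.
Proof. by move=> a x y; rewrite clsD -qscale_cls. Qed.
HB.instance Definition _ := GRing.isLinear.Build R M quotm _ cls cls_linear.
End Submod.

(** [span_mul I N] is the submodule of finite sums of products [a *: x] with
    [a] in [I] and [x] in [N]. *)
Section SpanMul.
Variables (R : comPzRingType) (M : lmodType R) (I : {pred R}) (N : {pred M}).
Hypothesis I_scale : forall a b, b \in I -> a * b \in I.

Definition span_mul : {pred M} := fun x =>
  `[< exists (n : nat) (a : 'I_n -> R) (y : 'I_n -> M),
      [/\ forall i, a i \in I, forall i, y i \in N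
        & x = \sum_i a i *: y i] >].

Lemma span_mul_closed : submod_closed span_mul.
Proof.
split=> [|c u v].
  by apply/asboolP; exists 0%N, (fun=> 0), (fun=> 0); split=> [[]|[]|] //;
     rewrite big_ord0.
move=> /asboolP[n [a [y [Ia Ny ->]]]] /asboolP[m [b [z [Ib Nz ->]]]].
apply/asboolP; exists (n + m)%N.
exists (fun i => match split i with inl i => c * a i | inr i => b i end).
exists (fun i => match split i with inl i => y i | inr i => z i end).
split=> [i|i|]; first by case: split => j; [apply: I_scale|].
  by case: split.
rewrite big_split_ord scaler_sumr; congr (_ + _); apply: eq_bigr => i _.
  by rewrite -[lshift _ _]/(unsplit (inl i)) unsplitK scalerA.
by rewrite -[rshift _ _]/(unsplit (inr i)) unsplitK.
Qed.
End SpanMul.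

Record opens (X : topologicalType) := Opens {
  oset :> set X;
  opensP : open oset }.

Definition topens (X : topologicalType) : opens X := Opens (@openT X).

(** Gluing is required over [C], an arbitrary set of opens covering [U];
    agreement on [Vi `&` Vj] is expressed on all opens contained in it. *)
Record ringed_space := RingedSpace {
  space :> topologicalType;
  sO : opens space -> comPzRingType;
  rres : forall U V : opens space, V `<=` U -> {rmorphism sO U -> sO V};
  rres_id : forall (U : opens space) (h : U `<=` U) a, rres h a = a;
  rres_comp : forall (U V W : opens space)
    (h : V `<=` U) (h' : W `<=` V) (h'' : W `<=` U) a,
    rres h' (rres h a) = rres h'' a;
  sheaf_sep : forall (U : opens space) (C : set (opens space)),
    (oset U = \bigcup_(V in C) oset V) ->
    forall a b : sO U,
    (forall (V : opens space) (h : V `<=` U), C V -> rres h a = rres h b) ->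
    a = b;
  sheaf_glue : forall (U : opens space) (C : set (opens space)),
    (oset U = \bigcup_(V in C) oset V) ->
    forall a : (forall V : opens space, sO V),
    (forall V V' W : opens space, C V -> C V' ->
       forall (h : W `<=` V) (h' : W `<=` V'),
       rres h (a V) = rres h' (a V')) ->
    exists b : sO U,
      forall (V : opens space) (h : V `<=` U), C V -> rres h b = a V }.

Section Affine.
Variable (X : ringed_space).

Definition is_unit (R : comPzRingType) (a : R) := exists b, a * b = 1.

(** The points of [U] where the germ of [f] is invertible. *)
Definition basic (U : opens X) (f : sO U) : set X :=
  [set x | exists (W : opens X) (h : W `<=` U), oset W x /\ is_unit (rres h f)].

Definition is_prime (R : comPzRingType) (P : set R) :=
  [/\ P 0, ~ P 1, (forall a b, P a -> P b -> P (a + b)),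
      (forall a b, P b -> P (a * b)) & forall a b, P (a * b) -> P a \/ P b].

Definition prime_at (U : opens X) (x : X) : set (sO U) := ~` [set f | basic f x].
Arguments prime_at U x : clear implicits.

(** The canonical map from [U] to the spectrum of [O(U)] is an isomorphism:
    a bijection onto the set of prime ideals, a homeomorphism for the Zariski
    topology, and [O(D(f))] is the localization of [O(U)] at [f]. *)
Record affine (U : opens X) : Prop := Affine {
  aff_prime : forall x, oset U x -> is_prime (prime_at U x);
  aff_inj : forall x y, oset U x -> oset U y -> prime_at U x = prime_at U y -> x = y;
  aff_surj : forall P : set (sO U), is_prime P -> exists2 x, oset U x & prime_at U x = P;
  aff_top : forall W : set X, W `<=` U ->
    (open W <-> exists F : set (sO U), W = \bigcup_(f in F) basic f);
  aff_loc : forall (f : sO U) (V : opens X) (h : V `<=` U), oset V = basic f ->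
    (forall b : sO V, exists n (a : sO U), rres h f ^+ n * b = rres h a) /\
    (forall a : sO U, rres h a = 0 -> exists n, f ^+ n * a = 0) }.
End Affine.

Record scheme := Scheme {
  rspace :> ringed_space;
  scheme_affine : forall x : rspace, exists2 U : opens rspace, oset U x & affine U }.

Record aff (S : scheme) := Aff {
  aopen :> opens S;
  affP : affine aopen }.

(** A quasi-coherent sheaf is given by its sections over the affine opens;
    the condition is that restriction to a distinguished open is localization.
    Cokernels, images, tensor products, and homomorphisms out of a finitely
    presented sheaf are then computed on each affine open. *)
Record qcoh (S : scheme) := QCoh {
  sec :> forall U : aff S, lmodType (sO U);
  qres : forall U V : aff S, V `<=` U -> sec U -> sec V;
  qres_lin : forall (U V : aff S) (h : V `<=` U) a x y,
    qres h (a *: x + y) = rres h a *: qres h x + qres h y;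
  qres_id : forall (U : aff S) (h : U `<=` U) x, qres h x = x;
  qres_comp : forall (U V W : aff S)
    (h : V `<=` U) (h' : W `<=` V) (h'' : W `<=` U) x,
    qres h' (qres h x) = qres h'' x;
  qres_loc : forall (U V : aff S) (h : V `<=` U) (f : sO U),
    oset V = basic f ->
    (forall y : sec V, exists n x, rres h f ^+ n *: y = qres h x) /\
    (forall x : sec U, qres h x = 0 -> exists n, f ^+ n *: x = 0) }.

Section QRes.
Variables (S : scheme) (M : qcoh S) (U V : aff S) (h : V `<=` U).
Lemma qres0 : qres h (0 : M U) = 0.
Proof. by have := qres_lin h (-1) (0 : M U) 0; rewrite scaler0 addr0 rmorphN1 scaleN1r addNr. Qed.
Lemma qresD (x y : M U) : qres h (x + y) = qres h x + qres h y.
Proof. by rewrite -[x]scale1r qres_lin rmorph1 !scale1r. Qed.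
Lemma qresZ a (x : M U) : qres h (a *: x) = rres h a *: qres h x.
Proof. by rewrite -[a *: x]addr0 qres_lin qres0 addr0. Qed.
Lemma qresB (x y : M U) : qres h (x - y) = qres h x - qres h y.
Proof. by rewrite qresD -scaleN1r qresZ rmorphN1 scaleN1r. Qed.
Lemma qres_sum n (x : 'I_n -> M U) : qres h (\sum_i x i) = \sum_i qres h (x i).
Proof. by apply: (big_morph (@qres _ M _ _ h) qresD qres0). Qed.
End QRes.

Record qhom (S : scheme) (M N : qcoh S) := Hom {
  hom_fun :> forall U : aff S, {linear M U -> N U};
  hom_res : forall (U V : aff S) (h : V `<=` U) x,
    hom_fun V (qres h x) = qres h (hom_fun U x) }.

Section StructureSheaf.
Variable S : scheme.
Let M (U : aff S) : lmodType (sO U) := (sO U)^o.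
Let r (U V : aff S) (h : V `<=` U) : M U -> M V := rres h.
Let r_lin (U V : aff S) (h : V `<=` U) a (x y : M U) :
  r h (a *: x + y) = rres h a *: r h x + r h y.
Proof.
exact: (etrans (rmorphD (rres h) (a * x) y)
               (congr1 (fun z => z + rres h y) (rmorphM (rres h) a x))).
Qed.
Definition OS : qcoh S := @QCoh S M r r_lin
  (fun U h => rres_id h) (fun U V W h h' h'' => rres_comp h h' h'')
  (fun U V h f => aff_loc (affP U) h (f := f)).
End StructureSheaf.

Record qsub (S : scheme) (M : qcoh S) := QSub {
  sub_sec :> forall U : aff S, submod (M U);
  sub_res : forall (U V : aff S) (h : V `<=` U) x,
    x \in sub_sec U -> qres h x \in sub_sec V;
  sub_loc : forall (U V : aff S) (h : V `<=` U) (f : sO U),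
    oset V = basic f -> forall x, qres h x \in sub_sec V ->
    exists n, f ^+ n *: x \in sub_sec U }.

Notation ideal_sheaf S := (qsub (OS S)).

Section SubSheaf.
Variables (S : scheme) (M : qcoh S) (N : qsub M).
Let L (U : aff S) : lmodType (sO U) := subm (N U).
Let r (U V : aff S) (h : V `<=` U) (x : L U) : L V :=
  Subm (sub_res h (svalP_ x)).
Let r_lin (U V : aff S) (h : V `<=` U) a (x y : L U) :
  r h (a *: x + y) = rres h a *: r h x + r h y.
Proof. by apply: val_inj; rewrite /= qres_lin. Qed.
Let r_id (U : aff S) (h : U `<=` U) (x : L U) : r h x = x.
Proof. by apply: val_inj; rewrite /= qres_id. Qed.
Let r_comp (U V W : aff S) (h : V `<=` U) (h' : W `<=` V) (h'' : W `<=` U)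
  (x : L U) : r h' (r h x) = r h'' x.
Proof. by apply: val_inj; rewrite /= (qres_comp h h' h''). Qed.
Let r_loc (U V : aff S) (h : V `<=` U) (f : sO U) : oset V = basic f ->
  (forall y : L V, exists n x, rres h f ^+ n *: y = r h x) /\
  (forall x : L U, r h x = 0 -> exists n, f ^+ n *: x = 0).
Proof.
move=> e; split=> [y|x /(congr1 val)/= x0].
  have [n [x E]] := (qres_loc M h e).1 (val y).
  have /(sub_loc e)[m Nx] : qres h x \in N V by rewrite -E; apply/smem_scale/valP.
  exists (m + n)%N, (Subm Nx); apply: val_inj.
  by rewrite /= qresZ -E scalerA exprD rmorphXn.
by have [n E] := (qres_loc M h e).2 _ x0; exists n; apply: val_inj.
Qed.
Definition sub_qcoh : qcoh S := QCoh r_lin r_id r_comp r_loc.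
End SubSheaf.

Section Quotient.
Variables (S : scheme) (M : qcoh S) (N : qsub M).
Let L (U : aff S) : lmodType (sO U) := quotm (N U).
Let r (U V : aff S) (h : V `<=` U) (x : L U) : L V := cls (N V) (qres h (rep x)).
Let r_cls (U V : aff S) (h : V `<=` U) (x : M U) :
  r h (cls (N U) x) = cls (N V) (qres h x).
Proof.
by apply/cls_eq; rewrite -qresB; apply/sub_res/cls_eq; rewrite repK.
Qed.
Let r_lin (U V : aff S) (h : V `<=` U) a (x y : L U) :
  r h (a *: x + y) = rres h a *: r h x + r h y.
Proof. by rewrite -[x]repK -[y]repK -linearP !r_cls qres_lin linearP. Qed.
Let r_id (U : aff S) (h : U `<=` U) (x : L U) : r h x = x.
Proof. by rewrite -[x]repK r_cls qres_id. Qed.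
Let r_comp (U V W : aff S) (h : V `<=` U) (h' : W `<=` V) (h'' : W `<=` U)
  (x : L U) : r h' (r h x) = r h'' x.
Proof. by rewrite -[x]repK !r_cls (qres_comp h h' h''). Qed.
Let r_loc (U V : aff S) (h : V `<=` U) (f : sO U) : oset V = basic f ->
  (forall y : L V, exists n x, rres h f ^+ n *: y = r h x) /\
  (forall x : L U, r h x = 0 -> exists n, f ^+ n *: x = 0).
Proof.
move=> e; split=> [y|x].
  have [n [x E]] := (qres_loc M h e).1 (rep y); exists n, (cls _ x).
  by rewrite -[y in LHS]repK -linearZ /= E r_cls.
rewrite -[0](linear0 (cls (N V))) => /cls_eq; rewrite subr0 => /(sub_loc e)[n Nx].
exists n; rewrite -[x]repK -linearZ /= -[0](linear0 (cls (N U))).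
by apply/cls_eq; rewrite subr0.
Qed.
Definition quot : qcoh S := QCoh r_lin r_id r_comp r_loc.

Definition qcls (U : aff S) : {linear M U -> quot U} := cls (N U).
Lemma qcls_res (U V : aff S) (h : V `<=` U) (x : M U) :
  qres h (qcls U x) = qcls V (qres h x).
Proof. exact: r_cls. Qed.
Lemma qcls_eq (U : aff S) (x y : M U) : qcls U x = qcls U y <-> x - y \in N U.
Proof. exact: cls_eq. Qed.
Definition qrep (U : aff S) (x : quot U) : M U := rep x.
Lemma qrepK (U : aff S) (x : quot U) : qcls U (qrep x) = x.
Proof. exact: repK. Qed.
End Quotient.
Arguments qcls {S M} N U.

Section ZeroSub.
Variables (S : scheme) (M : qcoh S).
Let z (U : aff S) : {pred M U} := pred1 0.
Let z_closed (U : aff S) : submod_closed (@z U).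
Proof.
split=> [|a x y]; first exact: eqxx.
by move=> /eqP-> /eqP->; apply/eqP; rewrite scaler0 addr0.
Qed.
Let z_res (U V : aff S) (h : V `<=` U) x :
  x \in Submod (@z_closed U) -> qres h x \in Submod (@z_closed V).
Proof. by move=> /eqP->; apply/eqP; rewrite qres0. Qed.
Let z_loc (U V : aff S) (h : V `<=` U) (f : sO U) : oset V = basic f ->
  forall x, qres h x \in Submod (@z_closed V) ->
  exists n, f ^+ n *: x \in Submod (@z_closed U).
Proof.
move=> e x /eqP x0; have [n E] := (qres_loc M h e).2 _ x0.
by exists n; apply/eqP.
Qed.
Definition zero_sub : qsub M := QSub z_res z_loc.
End ZeroSub.

Section IdealMul.
Variables (S : scheme) (I : ideal_sheaf S) (M : qcoh S).
Let I_scale (U : aff S) (a b : sO U) : b \in I U -> a * b \in I U.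
Proof. exact: (@smem_scale _ _ (I U)). Qed.
Let p (U : aff S) : {pred M U} := span_mul (I U) predT.
Let p_closed (U : aff S) : submod_closed (@p U).
Proof. by apply: span_mul_closed; apply: I_scale. Qed.
Let p_res (U V : aff S) (h : V `<=` U) x :
  x \in Submod (@p_closed U) -> qres h x \in Submod (@p_closed V).
Proof.
move=> /asboolP[n [a [y [Ia _ ->]]]]; apply/asboolP.
exists n, (fun i => rres h (a i)), (fun i => qres h (y i)); split=> // [i|].
  exact: (sub_res (q := I) h (Ia i)).
by rewrite qres_sum; apply: eq_bigr => i _; rewrite qresZ.
Qed.
Let p_loc (U V : aff S) (h : V `<=` U) (f : sO U) : oset V = basic f ->
  forall x, qres h x \in Submod (@p_closed V) ->
  exists n, f ^+ n *: x \in Submod (@p_closed U).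
Proof.
move=> e x; pose g := rres h f.
have gX n : g ^+ n = rres h (f ^+ n) by rewrite rmorphXn.
suff lift (y : M V) : y \in Submod (@p_closed V) ->
    exists n, exists2 w : M U, w \in Submod (@p_closed U) & qres h w = g ^+ n *: y.
  move=> /lift[n [w wU E]].
  have /(qres_loc M h e).2[m] : qres h (f ^+ n *: x - w) = 0.
    by rewrite qresB qresZ -gX E subrr.
  rewrite scalerBr scalerA -exprD => /eqP; rewrite subr_eq0 => /eqP E'.
  by exists (m + n)%N; rewrite E'; apply: smem_scale.
move=> /asboolP[n [a [z [Ia _ ->]]]].
apply: (big_ind (fun y : M V => exists n, exists2 w : M U,
    w \in Submod (@p_closed U) & qres h w = g ^+ n *: y)).
- by exists 0%N, 0; [exact: rpred0 | rewrite qres0 scaler0].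
- move=> y1 y2 [n1 [w1 I1 E1]] [n2 [w2 I2 E2]].
  exists (n1 + n2)%N, (f ^+ n2 *: w1 + f ^+ n1 *: w2).
    by apply: rpredD; apply: smem_scale.
  rewrite qresD !qresZ -!gX E1 E2 !scalerA scalerDr -!exprD.
  by rewrite [(n2 + n1)%N]addnC.
move=> i _; have [n1 [w E1]] := (qres_loc M h e).1 (z i).
have [n2 [b E2]] := (qres_loc (OS S) h e).1 (a i).
have /(sub_loc e)[n3 Ib] : qres (q := OS S) h b \in I V.
  by move: E2 => /= <-; apply: smem_scale.
exists (n3 + n2 + n1)%N, ((f ^+ n3 * b) *: w).
  apply/asboolP; exists 1%N, (fun=> f ^+ n3 * b), (fun=> w).
  by split=> //; rewrite big_ord1.
rewrite qresZ -E1 rmorphM -gX.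
have -> : rres h b = g ^+ n2 * a i by exact: esym E2.
rewrite !scalerA !exprD; congr (_ *: _).
by rewrite -!mulrA; congr (_ * (_ * _)); rewrite mulrC.
Qed.
Definition ideal_mul : qsub M := QSub p_res p_loc.
End IdealMul.

Record cartier (S : scheme) := Cartier {
  ideal :> ideal_sheaf S;
  cartier_loc : forall x : S, exists2 U : aff S, oset U x &
    exists2 t : sO U, (forall a, t * a = 0 -> a = 0) &
      forall b : sO U, b \in ideal U <-> exists a, b = t * a }.

Definition is_double (S : scheme) (D B : cartier S) :=
  forall (U : aff S) (a : sO U), a \in D U <-> a \in span_mul (B U) (B U).

(** Sheaves on the closed subscheme [Z] of ideal [J] are identified with
    [O_S]-modules killed by [J]; the restriction [M|_Z] is [M / J M]. *)
Definition restr (S : scheme) (M : qcoh S) (J : ideal_sheaf S) : qcoh S :=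
  quot (ideal_mul J M).
Notation "M '|_' J" := (restr M J) (at level 8, J at level 2, format "M '|_' J").
Definition rcls (S : scheme) (M : qcoh S) (J : ideal_sheaf S) (U : aff S) :
  {linear M U -> M|_J U} := qcls (ideal_mul J M) U.
Arguments rcls {S M} J {U}.
Lemma rcls_res (S : scheme) (M : qcoh S) (J : ideal_sheaf S) (U V : aff S)
  (h : V `<=` U) (x : M U) : qres h (rcls J x) = rcls J (qres h x).
Proof. exact: qcls_res. Qed.
Lemma rrepK (S : scheme) (M : qcoh S) (J : ideal_sheaf S) (U : aff S)
  (x : M|_J U) : rcls J (qrep x) = x.
Proof. exact: qrepK. Qed.

(** Locally free of rank [r] over [O_S / J], i.e. a vector bundle of rank [r]
    on the closed subscheme of ideal [J]. *)
Definition locally_free (S : scheme) (J : ideal_sheaf S) (r : nat) (M : qcoh S) :=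
  (forall (U : aff S) (a : sO U) (x : M U), a \in J U -> a *: x = 0) /\
  forall x : S, exists2 U : aff S, oset U x & exists e : 'I_r -> M U,
    (forall m, exists c : 'I_r -> sO U, m = \sum_i c i *: e i) /\
    (forall c : 'I_r -> sO U, \sum_i c i *: e i = 0 -> forall i, c i \in J U).

Definition vector_bundle (S : scheme) (r : nat) (M : qcoh S) :=
  locally_free (zero_sub (OS S)) r M.

(** A line subbundle, on the closed subscheme of ideal [J], of a vector bundle
    [M] of rank [r] on it: the quotient is locally free too. *)
Definition line_subbundle (S : scheme) (J : ideal_sheaf S) (r : nat) (M : qcoh S)
    (K : qsub M) :=
  locally_free J 1 (sub_qcoh K) /\ locally_free J r.-1 (quot K).

(** For [K] a subsheaf of [M|_D], the image of [K|_B -> M|_B]; here the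
    subscheme of [B] is contained in that of [D]. *)
Section SubRestr.
Variables (S : scheme) (M : qcoh S) (D B : ideal_sheaf S) (K : qsub M|_D).
Let p (U : aff S) : {pred M|_B U} := fun x =>
  `[< exists2 y : M U, rcls D y \in K U & x = rcls B y >].
Let p_closed (U : aff S) : submod_closed (@p U).
Proof.
split=> [|a x y].
  by apply/asboolP; exists 0; rewrite ?linear0 ?rpred0.
move=> /asboolP[x' Kx ->] /asboolP[y' Ky ->]; apply/asboolP.
exists (a *: x' + y'); last by rewrite linearP.
by rewrite linearP rpredD //; apply: smem_scale.
Qed.
Let p_res (U V : aff S) (h : V `<=` U) x :
  x \in Submod (@p_closed U) -> qres h x \in Submod (@p_closed V).
Proof.
move=> /asboolP[y Ky ->]; apply/asboolP; exists (qres h y).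
  by rewrite /rcls -qcls_res sub_res.
by rewrite /rcls qcls_res.
Qed.
Let p_loc (U V : aff S) (h : V `<=` U) (f : sO U) : oset V = basic f ->
  forall x, qres h x \in Submod (@p_closed V) ->
  exists n, f ^+ n *: x \in Submod (@p_closed U).
Proof.
move=> e x; rewrite -[x]qrepK; move: (qrep x) => {}x.
rewrite qcls_res => /asboolP[y Ky /esym/qcls_eq E].
have [n [z Ez]] := (qres_loc M h e).1 y.
have /(sub_loc e)[m Km] : qres h (rcls D z) \in K V.
  by rewrite /rcls qcls_res -Ez linearZ; apply: smem_scale.
have /(sub_loc e)[l] : qres h (z - f ^+ n *: x) \in ideal_mul B M V.
  rewrite qresB qresZ -Ez rmorphXn -scalerBr; exact: smem_scale.
rewrite scalerBr scalerA => /qcls_eq El.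
exists (m + (l + n))%N; apply/asboolP; exists (f ^+ (m + l) *: z).
  by rewrite linearZ /= addnC exprD -scalerA; apply: smem_scale.
rewrite exprD -scalerA exprD.
have -> : f ^+ l * f ^+ n *: qcls (ideal_mul B M) U x = rcls B (f ^+ l *: z).
  by rewrite /rcls El linearZ.
by rewrite -linearZ scalerA exprD.
Qed.
Definition sub_restr : qsub M|_B := QSub p_res p_loc.
End SubRestr.

Definition polar (V M N : zmodType) (q : V -> M -> N) (v : V) (x y : M) : N :=
  q v (x + y) - q v x - q v y.

(** A family [V -> Sym^2 M^dual (x) N] of quadratic forms on [M]. For [M] locally
    free over [S] (or over a closed subscheme on which [N] also lives), sections
    of [Sym^2 M^dual (x) N] are the [N]-valued quadratic forms on [M]: maps that
    are homogeneous of degree 2 and have a bilinear polar form. *)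
Record qfam (S : scheme) (V M N : qcoh S) := QFam {
  qf :> forall U : aff S, V U -> M U -> N U;
  qf_lin : forall (U : aff S) a (v w : V U) x,
    qf (a *: v + w) x = a *: qf v x + qf w x;
  qf_quad : forall (U : aff S) (v : V U) a x, qf v (a *: x) = a ^+ 2 *: qf v x;
  qf_polar : forall (U : aff S) (v : V U) a x y z,
    polar (@qf U) v (a *: x + y) z =
    a *: polar (@qf U) v x z + polar (@qf U) v y z;
  qf_res : forall (U W : aff S) (h : W `<=` U) v x,
    qf (qres h v) (qres h x) = qres h (qf v x) }.
Arguments qf {S V M N} q U v x.
Arguments qf_polar {S V M N} q {U}.
Arguments qf_lin {S V M N} q {U}.
Arguments qf_quad {S V M N} q {U}.

(** The restriction of a family to a closed subscheme, characterized by
    [qrestr_cls] below. *)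
Section QRestr.
Variables (S : scheme) (V M N : qcoh S) (q : qfam V M N) (J : ideal_sheaf S).
Let JP (L : qcoh S) (U : aff S) (P : L U -> Prop) : P 0 ->
  (forall x y, P x -> P y -> P (x + y)) ->
  (forall (a : sO U) x, a \in J U -> P (a *: x)) ->
  forall x, x \in ideal_mul J L U -> P x.
Proof.
move=> P0 PD PJ x /asboolP[n [a [y [Ja _ ->]]]].
by apply: (big_ind P) => // i _; apply: PJ.
Qed.
Let J_mul (L : qcoh S) (U : aff S) (a : sO U) (x : L U) :
  a \in J U -> a *: x \in ideal_mul J L U.
Proof.
move=> Ja; apply/asboolP; exists 1%N, (fun=> a), (fun=> x).
by split=> //; rewrite big_ord1.
Qed.
Let qDr (U : aff S) v x y :
  q U v (x + y) = q U v x + q U v y + polar (q U) v x y.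
Proof. by rewrite /polar [RHS]addrC -[_ - _ - _]addrA -opprD subrK. Qed.
Let q0l (U : aff S) x : q U 0 x = 0.
Proof. by have := qf_lin q (-1) 0 0 x; rewrite scaler0 addr0 scaleN1r addNr. Qed.
Let qDl (U : aff S) v w x : q U (v + w) x = q U v x + q U w x.
Proof. by rewrite -[v]scale1r qf_lin !scale1r. Qed.
Let qZl (U : aff S) a v x : q U (a *: v) x = a *: q U v x.
Proof. by rewrite -[a *: v]addr0 qf_lin q0l addr0. Qed.
Let p0 (U : aff S) v z : polar (q U) v 0 z = 0.
Proof. by have := qf_polar q v (-1) 0 0 z; rewrite scaler0 addr0 scaleN1r addNr. Qed.
Let pD (U : aff S) v x y z :
  polar (q U) v (x + y) z = polar (q U) v x z + polar (q U) v y z.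
Proof. by rewrite -[x]scale1r qf_polar !scale1r. Qed.
Let pZ (U : aff S) v a x z : polar (q U) v (a *: x) z = a *: polar (q U) v x z.
Proof. by rewrite -[a *: x]addr0 qf_polar p0 addr0. Qed.
Let pJ (U : aff S) v x z : x \in ideal_mul J M U ->
  polar (q U) v x z \in ideal_mul J N U.
Proof.
apply: (JP (P := fun x => polar (q U) v x z \in ideal_mul J N U)).
- by rewrite p0 rpred0.
- by move=> ? ? ? ?; rewrite pD rpredD.
by move=> a {}x Ja; rewrite pZ J_mul.
Qed.
Let qJl (U : aff S) v x : v \in ideal_mul J V U -> q U v x \in ideal_mul J N U.
Proof.
apply: (JP (P := fun v => q U v x \in ideal_mul J N U)).
- by rewrite q0l rpred0.
- by move=> ? ? ? ?; rewrite qDl rpredD.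
by move=> a {}v Ja; rewrite qZl J_mul.
Qed.
Let qJr (U : aff S) v x : x \in ideal_mul J M U -> q U v x \in ideal_mul J N U.
Proof.
move=> Jx; suff [] : x \in ideal_mul J M U /\ q U v x \in ideal_mul J N U by [].
move: x Jx; apply: JP.
- have -> : q U v 0 = 0.
    by have := qf_quad q v 0 0; rewrite scale0r expr0n scale0r.
  by rewrite !rpred0.
- move=> x y [Jx qx] [Jy qy]; split; first exact: rpredD.
  by rewrite qDr; apply: rpredD; [apply: rpredD|apply: pJ].
by move=> a x Ja; rewrite qf_quad expr2 -scalerA !J_mul.
Qed.
Let f (U : aff S) (v : V|_J U) (x : M|_J U) : N|_J U :=
  rcls J (q U (qrep v) (qrep x)).
Let f_cls (U : aff S) v x : @f U (rcls J v) (rcls J x) = rcls J (q U v x).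
Proof.
apply/qcls_eq; set v' := qrep _; set x' := qrep _.
have Jv : v' - v \in ideal_mul J V U by apply/qcls_eq; rewrite qrepK.
have Jx : x' - x \in ideal_mul J M U by apply/qcls_eq; rewrite qrepK.
have -> : q U v' x' - q U v x =
    q U (v' - v) x' + (q U v (x' - x) + polar (q U) v (x' - x) x).
  have := qDl (v' - v) v x'; rewrite subrK => ->.
  by have := qDr v (x' - x) x; rewrite subrK => ->; rewrite -addrA [_ - q U v x]addrAC addrK.
by apply: rpredD; [apply: qJl|apply: rpredD; [apply: qJr|apply: pJ]].
Qed.
Let f_lin (U : aff S) a (v w : V|_J U) x : f (a *: v + w) x = a *: f v x + f w x.
Proof.
by rewrite -[v]qrepK -[w]qrepK -[x]qrepK -linearP !f_cls qf_lin linearP.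
Qed.
Let f_quad (U : aff S) (v : V|_J U) a x : f v (a *: x) = a ^+ 2 *: f v x.
Proof. by rewrite -[v]qrepK -[x]qrepK -linearZ !f_cls qf_quad linearZ. Qed.
Let f_polar (U : aff S) (v : V|_J U) a x y z :
  polar (@f U) v (a *: x + y) z = a *: polar (@f U) v x z + polar (@f U) v y z.
Proof.
have E v0 x0 y0 : polar (@f U) (rcls J v0) (rcls J x0) (rcls J y0) =
    rcls J (polar (q U) v0 x0 y0).
  by rewrite /polar -linearD !f_cls !linearB.
by rewrite -[v]qrepK -[x]qrepK -[y]qrepK -[z]qrepK -linearP !E qf_polar linearP.
Qed.
Let f_res (U W : aff S) (h : W `<=` U) v x :
  f (qres h v) (qres h x) = qres h (@f U v x).
Proof.
by rewrite -[v]rrepK -[x]rrepK (rcls_res (M:=V)) (rcls_res (M:=M)) !f_cls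
  (rcls_res (M:=N)) qf_res.
Qed.
Definition qrestr : qfam V|_J M|_J N|_J := QFam f_lin f_quad f_polar f_res.
Lemma qrestr_cls (U : aff S) (v : V U) (x : M U) :
  qrestr U (rcls J v) (rcls J x) = rcls J (q U v x).
Proof. exact: f_cls. Qed.
End QRestr.

(** The dual of a finitely presented sheaf: on each affine open its sections
    are the linear functionals. *)
Record qdual (S : scheme) (M : qcoh S) := Dual {
  dual_sh :> qcoh S;
  ev : forall U : aff S, dual_sh U -> M U -> OS S U;
  ev_linl : forall (U : aff S) a (l l' : dual_sh U) m,
    ev (a *: l + l') m = a *: ev l m + ev l' m;
  ev_linr : forall (U : aff S) a (l : dual_sh U) m m',
    ev l (a *: m + m') = a *: ev l m + ev l m';
  ev_res : forall (U V : aff S) (h : V `<=` U) l m,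
    ev (qres h l) (qres h m) = qres h (ev l m);
  ev_perfect : forall (U : aff S) (phi : {linear M U -> OS S U}),
    exists! l : dual_sh U, forall m, ev l m = phi m }.
Arguments ev {S M} q {U} l m.

Definition bilin (R : comPzRingType) (M N P : lmodType R) (b : M -> N -> P) :=
  (forall a x x' y, b (a *: x + x') y = a *: b x y + b x' y) /\
  (forall a x y y', b x (a *: y + y') = a *: b x y + b x y').

Record qtensor (S : scheme) (M N : qcoh S) := Tensor {
  tens :> qcoh S;
  tmul : forall U : aff S, M U -> N U -> tens U;
  tmul_bilin : forall U : aff S, bilin (@tmul U);
  tmul_res : forall (U V : aff S) (h : V `<=` U) m n,
    tmul (qres h m) (qres h n) = qres h (tmul m n);
  tens_univ : forall (U : aff S) (P : lmodType (sO U)) (b : M U -> N U -> P),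
    bilin b ->
    (exists g : {linear tens U -> P}, forall m n, g (tmul m n) = b m n) /\
    (forall g g' : {linear tens U -> P},
       (forall m n, g (tmul m n) = g' (tmul m n)) -> g =1 g') }.
Arguments tmul {S M N} q {U} m n.

(** [O_S(D)], the dual of the ideal sheaf of [D]. *)
Notation OofD D := (qdual (sub_qcoh D)).

Section Hecke.
Variables (S : scheme) (r : nat) (V E : qcoh S) (D B : cartier S)
  (K : qsub E|_D).

(** [K] is contained in the kernel of [q|_D]: the composition
    [V|_D -> Sym^2 (E|_D)^dual -> (E|_D)^dual (x) K^dual] vanishes. *)
Definition in_kernel (q : qfam V E (OS S)) :=
  forall (U : aff S) (v : V|_D U) (x y : E|_D U), y \in K U ->
    polar (qrestr q D U) v x y = 0.

(** The Hecke transform of [E]: a vector bundle [Et] with [j : E -> Et] whose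
    dual map identifies the dual of [Et] with the kernel of
    [E^dual -> (K|_B)^dual]. *)
Record hecke := Hecke {
  hecke_sh :> qcoh S;
  hecke_bundle : vector_bundle r hecke_sh;
  hecke_j : qhom E hecke_sh;
  hecke_inj : forall (U : aff S) (psi psi' : {linear hecke_sh U -> OS S U}),
    (forall x, psi (hecke_j U x) = psi' (hecke_j U x)) -> psi =1 psi';
  hecke_im : forall (U : aff S) (phi : {linear E U -> OS S U}),
    (exists psi : {linear hecke_sh U -> OS S U},
       forall x, psi (hecke_j U x) = phi x) <->
    (forall x, rcls D x \in K U -> phi x \in B U) }.

(** [x] is the section [l (x) y] of [E(B)], where [l] is a section of [O_S(B)]
    and [y] a section of [E]; here [Et] is seen as a subsheaf of [E(B)]. *)
Definition is_lmul (OB : OofD B) (Et : hecke) (U : aff S)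
    (l : OB U) (y : E U) (x : Et U) :=
  forall a : sub_qcoh B U, (val a : sO U) *: x = (ev OB l a : sO U) *: hecke_j Et U y.

(** [p] is the epimorphism of the dual exact sequence
    [0 -> E -> Et -> K_B(B) -> 0], where [K_B(B)] is [K|_B (x) O_S(B)]. It is the
    restriction to [Et] of the projection [E(B) -> E_B(B)]. *)
Record hecke_proj (OB : OofD B) (KB : qtensor (sub_qcoh K)|_B OB) (Et : hecke)
    (p : qhom Et KB) : Prop := HeckeProj {
  hproj_inj : forall U : aff S, injective (hecke_j Et U);
  hproj_surj : forall (U : aff S) (t : KB U), exists x, p U x = t;
  hproj_ker : forall (U : aff S) (x : Et U),
    p U x = 0 <-> exists y, x = hecke_j Et U y;
  hproj_lmul : forall (U : aff S) (l : OB U) (y : E U) (kap : sub_qcoh K U) (x : Et U),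
    rcls D y = val kap -> is_lmul l y x -> p U x = tmul KB (rcls B kap) l }.

(** The Hecke transform of [q]: composed with [Sym^2 Et^dual -> Sym^2 E^dual]
    it gives [q]. *)
Definition hecke_qfam (Et : hecke) (q : qfam V E (OS S)) (qt : qfam V Et (OS S)) :=
  forall (U : aff S) (v : V U) (x : E U), qt U v (hecke_j Et U x) = q U v x.

(** On [U], [e] generates a line subbundle of [E] that extends [K]; the
    generator [kap] of [K] is its restriction to [D]. *)
Definition local_extension (U : aff S) (e : E U) (kap : sub_qcoh K U) :=
  [/\ exists2 b : 'I_r -> E U,
        (forall x, exists! c : {ffun 'I_r -> sO U}, x = \sum_i c i *: b i)
        & exists i, e = b i,
      rcls D e = val kap
    & forall kap', exists a : sO U, kap' = a *: kap].

(** The residual family [V(D)|_D -> Sym^2 K^dual]: for a local line subbundle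
    extending [K], with generator [e], a section [v (x) d] of [V(D)] is sent to
    [d . q(v, e)], where [d . c] for [c] in the ideal of [D] is the section [z]
    with [a * z = d(a) * c] for all [a] in this ideal. *)
Definition residual (q : qfam V E (OS S)) (OD : OofD D) (VD : qtensor V OD)
    (rho : qfam VD|_D (sub_qcoh K) (OS S)|_D) :=
  forall (U : aff S) (e : E U) (kap : sub_qcoh K U), local_extension e kap ->
  forall (v : V U) (d : OD U) (z : sO U),
    (forall a : sub_qcoh D U,
       (val a : sO U) * z = (ev OD d a : sO U) * (q U v e : sO U)) ->
    rho U (rcls D (tmul VD v d)) kap = rcls D (z : OS S U).

(** The restriction to [B] of [rho : V(D)|_D -> Sym^2 K^dual], viewed as a morphism
    [V|_B -> Sym^2 (K_B(B))^dual] by means of [O_S(B)^2 = O_S(D)]: the value of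
    [rhoB] on [v] and [kap (x) l] is that of [rho] on [v (x) l^2] and [kap]. *)
Definition residual_restr (OB : OofD B) (OD : OofD D)
    (KB : qtensor (sub_qcoh K)|_B OB) (VD : qtensor V OD)
    (rho : qfam VD|_D (sub_qcoh K) (OS S)|_D)
    (rhoB : qfam V|_B KB (OS S)|_B) :=
  forall (U : aff S) (v : V U) (kap : sub_qcoh K U) (l : OB U) (d : OD U)
    (z : OS S U),
    (forall (a b : sub_qcoh B U) (c : sub_qcoh D U),
       val c = (val a : sO U) * (val b : sO U) ->
       ev OD d c = (ev OB l a : sO U) * (ev OB l b : sO U)) ->
    rho U (rcls D (tmul VD v d)) kap = rcls D z ->
    rhoB U (rcls B v) (tmul KB (rcls B kap) l) = rcls B z.
End Hecke.

(** The splitting of [Et|_B -> K_B(B)] that defines the canonical decomposition: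
    if [y] lifts a section [kap] of [K] and the section [l (x) y] of [E(B)] lies
    in [Et], then its class in [Et|_B] is the image of [kap (x) l]. So, for any
    local line subbundle [Kt] of [E] extending [K], the composition
    [Kt(B) -> Et -> Et|_B] is the splitting precomposed with
    [Kt(B) -> K_B(B)]. *)
Definition canonical_splitting (S : scheme) (r : nat) (E : qcoh S)
    (D B : cartier S) (K : qsub E|_D) (Et : hecke r B K) (OB : OofD B)
    (KB : qtensor (sub_qcoh K)|_B OB) (s : qhom KB Et|_B) :=
  forall (U : aff S) (l : OB U) (y : E U) (kap : sub_qcoh K U) (x : Et U),
    rcls D y = val kap -> is_lmul l y x ->
    s U (tmul KB (rcls B kap) l) = rcls B x.

(* Main.v *)
Require Import Defs.
From HB Require Import structures.
From mathcomp Require Import all_boot all_order all_algebra.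
From mathcomp Require Import boolp classical_sets topology.

(** Let [Kt] be the preimage of [K] in [E]. Near a point, [B] has an equation [t],
    a nonzerodivisor, [D] has the equation [t ^ 2], and [Et] is [E + t^-1 Kt],
    a subsheaf of [E(B)]. The canonical splitting sends [kap (x) l] to the class in
    [Et|_B] of [l (x) y], where [y] lifts [kap] to [E]. Two lifts differ by a
    section of [t ^ 2 E], so that the two sections [l (x) y] differ by a section of
    [t E], which vanishes in [Et|_B]: this is [lmul_zero], and it is the reason why
    [D] has to be double. The other summand is the image of [E] in [Et|_B]: a
    section [j y] vanishes on [B] exactly when [y] lies in [Kt + t E]
    ([j_inK] and [j_ideal]), so this image is [E|_B] modulo [K|_B].

    A section [x] of [Et] that represents an element of the second summand
    satisfies [t x = j y'] with [y'] in [Kt]. Hence [t polar(j y, x)] is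
    [polar(y, y')], which [t ^ 2] divides because [K] is in the kernel of [q|_D];
    so [polar(j y, x)] vanishes on [B] ([splitting_orthogonal]). If [e] is a
    generator of a line subbundle extending [K] and [t x = j e], then
    [q v e = t ^ 2 qt v x], so that [qt v x] is the value of the residual family
    ([residual_splitting]). Such a line subbundle exists near each point of [D]:
    lifts to [E] of a generator of [K] and of a basis of [E|_D / K] form a matrix
    whose determinant is invertible on [D] ([extension_frame]); away from [D],
    both sides of the equality vanish.

    Sheaves being given by their sections over all affine opens, these local
    computations have to be carried to an arbitrary affine open [U]. Distinguished
    opens of [U] are affine ([affine_basic]), and an ideal of functions on [U]
    without common zero contains [1] ([ideal_local]); so membership in a
    quasi-coherent subsheaf can be tested near each point ([sub_local]). The
    section [l (x) y] of [Et] over [U] is the solution of the system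
    [a x = l(a) j y], for [a] in the ideal of [B]; it exists because it does
    locally and this ideal is finitely generated ([division_local]). *)

Set Implicit Arguments.
Unset Strict Implicit.
Unset Printing Implicit Defensive.

Import GRing.Theory.
Local Open Scope classical_set_scope.
Local Open Scope ring_scope.

(** * Distinguished opens of an affine open *)

Lemma is_unit_rmorph (R R' : comPzRingType) (f : {rmorphism R -> R'}) a :
  is_unit a -> is_unit (f a).
Proof. by move=> [b e]; exists (f b); rewrite -rmorphM e rmorph1. Qed.

Lemma is_unitM (R : comPzRingType) (a b : R) :
  is_unit (a * b) <-> is_unit a /\ is_unit b.
Proof.
split=> [[c e]|[[c e] [d e']]].
  by split; [exists (b * c); rewrite mulrA|exists (a * c); rewrite mulrCA mulrA].
by exists (c * d); rewrite mulrACA e e' mulr1.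
Qed.

Lemma is_unitX (R : comPzRingType) (a : R) n : is_unit a -> is_unit (a ^+ n).
Proof. by move=> [b e]; exists (b ^+ n); rewrite -exprMn e expr1n. Qed.

Section Basic.
Variable X : ringed_space.
Implicit Types U V W : opens X.

Definition opensI U V : opens X := Opens (openI (opensP U) (opensP V)).

Lemma basic_sub U (f : sO U) : basic f `<=` U.
Proof. by move=> x [W [h [Wx _]]]; apply: h. Qed.

Lemma basicT U (f : sO U) : is_unit f -> basic f = U.
Proof.
move=> u; apply/seteqP; split=> [|x Ux]; first exact: basic_sub.
by exists U, (@subset_refl _ U); split=> //; apply: is_unit_rmorph.
Qed.

Lemma basic_res U V (h : V `<=` U) (f : sO U) : basic (rres h f) = basic f `&` V.
Proof.
apply/seteqP; split=> x.
  move=> bx; split; last exact: basic_sub bx.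
  have [W [h' [Wx u]]] := bx; exists W, (subset_trans h' h); split=> //.
  by rewrite -(rres_comp h h').
move=> [[W [h' [Wx u]]] Vx].
have hW : opensI W V `<=` W by move=> ? [].
have hV : opensI W V `<=` V by move=> ? [].
exists (opensI W V), hV; split; first by split.
rewrite (rres_comp h hV (subset_trans hW h')).
by rewrite -(rres_comp h' hW); apply: is_unit_rmorph.
Qed.

Lemma basicM U (f g : sO U) : basic (f * g) = basic f `&` basic g.
Proof.
apply/seteqP; split=> x.
  move=> [W [h [Wx]]]; rewrite rmorphM => /is_unitM[uf ug].
  by split; exists W, h.
move=> [[W [h [Wx u]]] [W' [h' [Wx' u']]]].
have hW : opensI W W' `<=` W by move=> ? [].
have hW' : opensI W W' `<=` W' by move=> ? [].
exists (opensI W W'), (subset_trans hW h); split; first by split.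
rewrite rmorphM; apply/is_unitM; split.
  by rewrite -(rres_comp h hW); apply: is_unit_rmorph.
by rewrite -(rres_comp h' hW' (subset_trans hW h)); apply: is_unit_rmorph.
Qed.

Lemma basicX U (f : sO U) n x : basic f x -> basic (f ^+ n) x.
Proof.
move=> [W [h [Wx u]]]; exists W, h; split=> //.
by rewrite rmorphXn; apply: is_unitX.
Qed.

(** The local inverses are unique, hence glue. *)
Lemma basic_unit U (f : sO U) : U `<=` basic f -> is_unit f.
Proof.
move=> fU.
pose C := [set V : opens X | exists h : V `<=` U, is_unit (rres h f)].
have cov : oset U = \bigcup_(V in C) oset V.
  apply/seteqP; split=> x.
    by move=> /fU[W [h [Wx u]]]; exists W => //; exists h.
  by move=> [W [h _] Wx]; apply: h.
have inv V : exists b : sO V, forall (h : V `<=` U), C V -> rres h f * b = 1.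
  case: (pselect (C V)) => [CV|nCV]; last by exists 0 => h /nCV.
  have [h [b e]] := CV; exists b => h' _.
  by rewrite (Prop_irrelevance h' h).
pose a V := sval (cid (inv V)).
have aP V (h : V `<=` U) : C V -> rres h f * a V = 1.
    by rewrite /a; case: cid => b /= e; apply: e.
have [|b bP] := sheaf_glue cov (a := a).
  move=> V V' W CV CV' h h'.
  have [k _] := CV; have [k' _] := CV'.
  have e : rres (subset_trans h k) f * rres h (a V) = 1.
    by rewrite -(rres_comp k h) -rmorphM aP // rmorph1.
  have e' : rres (subset_trans h k) f * rres h' (a V') = 1.
    by rewrite -(rres_comp k' h') -rmorphM aP // rmorph1.
  by rewrite -[LHS]mulr1 -e' mulrCA mulrA e mul1r.
exists b; apply: (sheaf_sep cov) => V h CV.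
by rewrite rmorphM rmorph1 (bP V h CV) aP.
Qed.

Lemma unit_on_basic U V (h : V `<=` U) (f : sO U) :
  oset V = basic f -> is_unit (rres h f).
Proof.
by move=> e; apply: basic_unit => x Vx; rewrite basic_res; split=> //; rewrite -e.
Qed.

Section InAffine.
Variables (U : opens X) (hU : affine U).

Lemma open_basic (f : sO U) : open (basic f).
Proof.
apply/(aff_top hU); first exact: basic_sub.
by exists [set f]; rewrite bigcup_set1.
Qed.

Lemma basic0 x : ~ basic (0 : sO U) x.
Proof. by move=> bx; have [+ _ _ _ _] := aff_prime hU (basic_sub bx); apply. Qed.

Lemma basicD (f g : sO U) x : basic (f + g) x -> basic f x \/ basic g x.
Proof.
move=> bx; have [_ _ pD _ _] := aff_prime hU (basic_sub bx).
case: (pselect (basic f x)) => [|nf]; first by left.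
case: (pselect (basic g x)) => [|ng]; first by right.
by have /(_ bx) := pD _ _ nf ng.
Qed.

Lemma basic_nbhs (W : set X) x : open W -> W x -> oset U x ->
  exists2 f : sO U, basic f x & basic f `<=` W.
Proof.
move=> oW Wx Ux.
have : open (W `&` U) by apply: openI => //; apply: opensP.
move=> /(aff_top hU) [] // F e.
have : (W `&` U) x by [].
rewrite e => -[f Ff fx]; exists f => // y fy.
by have : (W `&` U) y by [rewrite e; exists f]; case.
Qed.

Definition dopen (f : sO U) : opens X := Opens (open_basic f).

Lemma dopen_sub (f : sO U) : dopen f `<=` U. Proof. exact: basic_sub. Qed.

Section Distinguished.
Variables (f : sO U) (V : opens X) (h : V `<=` U) (e : oset V = basic f).

Lemma basic_lift (b : sO V) : exists2 g : sO U, basic g `<=` V & basic b = basic g.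
Proof.
have [n [a E]] := (aff_loc hU h e).1 b.
exists (f * a); first by rewrite basicM e => x [].
rewrite basicM -e setIC -basic_res -E basicM.
rewrite (basicT (is_unitX n (unit_on_basic h e))).
by apply/esym/setIidr; apply: basic_sub.
Qed.

Lemma basic_restr (g : sO U) : basic g `<=` V -> basic (rres h g) = basic g.
Proof. by move=> gV; rewrite basic_res; apply: setIidl. Qed.

(** The primes of the localization [O(V)] are the extensions of the primes of
    [O(U)] that do not contain [f], that is, the points of [V]. *)
Lemma affine_basic : affine V.
Proof.
have u : is_unit (rres h f) by apply: unit_on_basic.
have pres x (g : sO U) : oset V x -> prime_at x g <-> prime_at x (rres h g).
  by move=> Vx; rewrite /prime_at /= basic_res; split=> [n [/n]|n bx] //; apply: n.
split.
- move=> x Vx.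
  have nb (b : sO V) : prime_at x b <->
      exists n a, rres h f ^+ n * b = rres h a /\ prime_at x a.
    split=> [pb|[n [a [E /(pres _ _ Vx)]]]].
      have [n [a E]] := (aff_loc hU h e).1 b; exists n, a; split=> //.
      by apply/(pres _ _ Vx); rewrite -E /prime_at /= basicM => -[].
    rewrite -E /prime_at /= basicM => pa bx; apply: pa; split=> //.
    by rewrite (basicT (is_unitX n u)).
  have [p0 p1 pD pM pP] := aff_prime hU (h Vx).
  split.
  + by rewrite -(rmorph0 (rres h)); apply/(pres _ _ Vx).
  + by rewrite -(rmorph1 (rres h)) => /(pres _ _ Vx).
  + move=> a b /nb[n [a' [Ea pa]]] /nb[m [b' [Eb pb]]]; apply/nb.
    exists (n + m)%N, (f ^+ m * a' + f ^+ n * b'); split.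
      rewrite rmorphD !rmorphM !rmorphXn -Ea -Eb mulrDr exprD !mulrA.
      by congr (_ * _ + _); rewrite mulrC.
    by apply: pD; apply: pM.
  + by move=> a b pb; rewrite /prime_at /= basicM => -[_].
  + move=> a b; rewrite /prime_at /= basicM => pab.
    case: (pselect (basic a x)) => [ax|]; last by left.
    by right=> bx; apply: pab.
- move=> x y Vx Vy E; apply: (aff_inj hU); [exact: h|exact: h|].
  apply/seteqP; split=> g.
    by move=> /(pres _ _ Vx); rewrite E => /(pres _ _ Vy).
  by move=> /(pres _ _ Vy); rewrite -E => /(pres _ _ Vx).
- move=> P [p0 p1 pD pM pP].
  pose Q := [set g | P (rres h g)].
  have Qp : is_prime Q.
    split; rewrite /Q /=.
    + by rewrite rmorph0.
    + by rewrite rmorph1.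
    + by move=> a b; rewrite rmorphD; apply: pD.
    + by move=> a b; rewrite rmorphM; apply: pM.
    + by move=> a b; rewrite rmorphM; apply: pP.
  have [x Ux E] := aff_surj hU Qp.
  have Vx : oset V x.
    rewrite e; apply: contrapT => nf.
    have : Q f by rewrite -E.
    by have [g Eg] := u; rewrite /Q /= => /(pM g); rewrite mulrC Eg.
  have QE a : P (rres h a) = prime_at x a by rewrite E.
  exists x => //; apply/seteqP.
  have PX n b : P (rres h f ^+ n * b) -> P b.
    move=> Pn; have [g Eg] := is_unitX n u.
    by rewrite -[b]mul1r -Eg mulrAC mulrC; apply: pM.
  split=> b.
    have [n [a Ea]] := (aff_loc hU h e).1 b.
    move=> pb; apply: (PX n); rewrite Ea QE.
    by apply/(pres _ _ Vx); rewrite -Ea /prime_at /= basicM => -[].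
  have [n [a Ea]] := (aff_loc hU h e).1 b.
  move=> /(pM (rres h f ^+ n)); rewrite Ea QE => /(pres _ _ Vx).
  rewrite -Ea /prime_at /= basicM => pa bx; apply: pa; split=> //.
  by rewrite (basicT (is_unitX n u)).
- move=> W WV; split=> [oW|[F ->]]; last first.
    apply: bigcup_open => b _; have [g _ ->] := basic_lift b; exact: open_basic.
  have [F E] := (aff_top hU (subset_trans WV h)).1 oW.
  have FV g : F g -> basic g `<=` V.
    by move=> Fg x gx; apply: WV; rewrite E; exists g.
  exists (rres h @` F); rewrite bigcup_image E.
  by apply: eq_bigcupr => g /FV/basic_restr.
move=> b V' h' e'.
have [n [a Ea]] := (aff_loc hU h e).1 b.
have h'' := subset_trans h' h.
have e'' : oset V' = basic (f * a).
  rewrite e' basicM -e setIC -basic_res -Ea basicM (basicT (is_unitX n u)).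
  by apply/esym/setIidr; apply: basic_sub.
have bE m : rres h (f * a) ^+ m = (rres h f ^+ n.+1) ^+ m * b ^+ m.
  by rewrite rmorphM -Ea mulrA -exprS exprMn.
have [w Ew] := u.
have wX m : w ^+ m * (rres h f) ^+ m = 1 by rewrite -exprMn mulrC Ew expr1n.
split=> [c|c c0].
  have [m [c' E]] := (aff_loc hU h'' e'').1 c.
  exists m, (w ^+ (n.+1 * m) * rres h c').
  have -> : rres h' b ^+ m = rres h' (w ^+ (n.+1 * m) * rres h (f * a) ^+ m).
    by rewrite bE -exprM mulrA wX mul1r rmorphXn.
  rewrite rmorphM -mulrA [RHS]rmorphM; congr (_ * _).
  by rewrite rmorphXn !(rres_comp h h' h'').
have [m [c' E]] := (aff_loc hU h e).1 c.
have /(aff_loc hU h'' e'').2[k Ek] : rres h'' c' = 0.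
  by rewrite -(rres_comp h h' h'') -E rmorphM c0 mulr0.
exists k.
have : rres h ((f * a) ^+ k * c') = 0 by rewrite Ek rmorph0.
rewrite rmorphM rmorphXn bE -E -exprM => E0.
rewrite -[LHS]mul1r -(wX (n.+1 * k + m)%N) exprD -[LHS]mulrA.
suff -> : rres h f ^+ (n.+1 * k + m) * (b ^+ k * c) = 0 by rewrite mulr0.
by rewrite -E0 exprD -!mulrA; congr (_ * _); rewrite mulrCA.
Qed.
End Distinguished.
End InAffine.
End Basic.

(** * Local arguments on an affine open *)

Section IdealLocal.
Variables (X : ringed_space) (U : opens X) (hU : affine U).

Definition is_ideal (R : comPzRingType) (I : set R) :=
  [/\ I 0, (forall a b, I a -> I b -> I (a + b)) & forall a b, I b -> I (a * b)].

Lemma maximal_prime (R : comPzRingType) (M : set R) :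
  is_ideal M -> ~ M 1 ->
  (forall J, is_ideal J -> M `<=` J -> ~ J 1 -> J `<=` M) -> is_prime M.
Proof.
move=> [M0 MD MM] M1 Mmax; split=> // a b Mab.
have ext c : ~ M c -> exists m d, M m /\ m + d * c = 1.
  move=> nc; apply: contrapT => H; apply: nc.
  pose J := [set z | exists m d, M m /\ z = m + d * c].
  apply: (Mmax J).
  - split; first by exists 0, 0; rewrite mul0r addr0.
      move=> _ _ [m [d [Mm ->]]] [m' [d' [Mm' ->]]].
      by exists (m + m'), (d + d'); rewrite mulrDl addrACA; split=> //; apply: MD.
    move=> z _ [m [d [Mm ->]]]; exists (z * m), (z * d).
    by rewrite mulrDr mulrA; split=> //; apply: MM.
  - by move=> m Mm; exists m, 0; rewrite mul0r addr0.
  - by move=> [m [d [Mm /esym E]]]; apply: H; exists m, d.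
  by exists 0, 1; rewrite mul1r add0r.
apply: contrapT => /not_orP[/ext[m [d [Mm E]]] /ext[m' [d' [Mm' E']]]]; apply: M1.
rewrite -[1]mulr1 -[X in X * _]E -[X in _ * X]E'.
rewrite mulrDl; apply: (MD); first by rewrite mulrC; apply: MM.
rewrite mulrDr; apply: (MD); first exact: MM.
by rewrite mulrACA; apply: MM.
Qed.

(** A proper ideal lies in a maximal one by Zorn's lemma, and the corresponding
    point of [U] is a common zero. *)
Lemma ideal_local (I : set (sO U)) : is_ideal I ->
  (forall x, oset U x -> exists2 g, I g & basic g x) -> I 1.
Proof.
move=> Iid cov; apply: contrapT => I1.
pose P J := J = set0 \/ [/\ is_ideal J, I `<=` J & ~ J 1].
have [F FP Ftot|M [PM Mmax]] := Zorn_bigcup (P := P).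
  case: (pselect (exists2 J, F J & J !=set0)) => [[J FJ nJ]|no]; last first.
    left; apply/seteqP; split=> // a [J FJ Ja]; apply: no.
    by exists J => //; exists a.
  have Fid K a : F K -> K a -> [/\ is_ideal K, I `<=` K & ~ K 1].
    by move=> /FP[->|] //.
  right; split.
  - have [a Ja] := nJ; have [[J0 _ _] _ _] := Fid _ _ FJ Ja.
    split; first by exists J.
      move=> b c [K FK Kb] [L FL Lc].
      have [[_ KD _] _ _] := Fid _ _ FK Kb; have [[_ LD _] _ _] := Fid _ _ FL Lc.
      have [KL|LK] := Ftot _ _ FK FL.
        by exists L => //; apply: LD => //; apply: KL.
      by exists K => //; apply: KD => //; apply: LK.
    move=> b c [K FK Kc]; have [[_ _ KM] _ _] := Fid _ _ FK Kc.
    by exists K => //; apply: KM.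
  - move=> b Ib; exists J => //; have [a Ja] := nJ.
    by have [_ IJ _] := Fid _ _ FJ Ja; apply: IJ.
  by move=> [K FK K1]; have [_ _] := Fid _ _ FK K1.
case: PM => [M0|[Mid IM M1]].
  apply: (Mmax I); last by right; split.
  by rewrite M0; split=> [a []|/(_ 0)]; case: Iid => I0 _ _ /(_ I0).
have [J Jid MJ J1|x Ux E] := aff_surj hU (maximal_prime Mid M1 _).
  apply: contrapT => JM; apply: (Mmax J); first by split.
  by right; split=> //; apply: subset_trans MJ.
have [g /IM Mg gx] := cov x Ux.
by move: Mg; rewrite -E; apply.
Qed.
End IdealLocal.

Section Scheme.
Variable S : scheme.
Implicit Types U V W : aff S.

Definition dist U (f : sO U) : aff S :=
  Aff (affine_basic (affP U) (@dopen_sub _ _ (affP U) f) erefl).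

Lemma dist_sub U (f : sO U) : dist f `<=` U. Proof. exact: basic_sub. Qed.

Section Localize.
Variables (M : qcoh S) (U W : aff S) (h : W `<=` U) (f : sO U).
Hypothesis e : oset W = basic f.

Lemma res_unit : is_unit (rres h f). Proof. exact: unit_on_basic. Qed.

Lemma loc_gen (N : qsub M) (y : M W) : y \in N W ->
  exists c, exists2 x : M U, x \in N U & y = c *: qres h x.
Proof.
move=> Ny; have [n [x E]] := (qres_loc M h e).1 y.
have /(sub_loc e)[m Nx] : qres h x \in N W by rewrite -E; apply: smem_scale.
have [c Ec] := is_unitX (m + n) res_unit.
exists c, (f ^+ m *: x) => //.
rewrite qresZ -E rmorphXn !scalerA.
by rewrite -exprD mulrC Ec scale1r.
Qed.

Lemma loc_gen1 (y : M W) : exists c, exists x : M U, y = c *: qres h x.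
Proof.
have [n [x E]] := (qres_loc M h e).1 y.
have [c Ec] := is_unitX n res_unit.
by exists c, x; rewrite -E scalerA mulrC Ec scale1r.
Qed.
End Localize.

Lemma nbhs_dist U x (O : set S) : open O -> oset U x -> O x ->
  exists2 f : sO U, basic f x & dist f `<=` O.
Proof. by move=> oO Ux Ox; apply: basic_nbhs => //; apply: affP. Qed.

(** A function on a distinguished open of [V] is, up to a unit, the restriction of
    a function on [V]; so distinguished opens can be nested from [U] to [V] and
    back. *)
Lemma common_basic U V x : oset U x -> oset V x ->
  exists f : sO U, basic f x /\ exists2 g : sO V, dist f `<=` V & basic f = basic g.
Proof.
move=> Ux Vx.
have [g gx gU] := nbhs_dist (opensP U) Vx Ux.
have [f fx fg] := nbhs_dist (opensP (dist g)) Ux gx.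
have gV : dist g `<=` V by apply: dist_sub.
have [g' _ E] := basic_lift (affP V) gV erefl (rres gU f).
exists f; split=> //; exists g'; first exact: subset_trans fg gV.
by rewrite -E basic_res; apply/esym/setIidl.
Qed.

(** Such properties hold on arbitrarily small distinguished opens of any affine
    open, and finitely many of them hold simultaneously. *)
Record local_prop (P : aff S -> Prop) : Prop := LocalProp {
  lp_dist : forall U W (h : W `<=` U) (f : sO U), oset W = basic f -> P U -> P W;
  lp_ex : forall x : S, exists2 U : aff S, oset U x & P U }.

Lemma lp_in P : local_prop P -> forall U x, oset U x ->
  exists2 f : sO U, basic f x & P (dist f).
Proof.
move=> HP U x Ux; have [V Vx PV] := lp_ex HP x.
have [f [fx [g fV E]]] := common_basic Ux Vx.
by exists f => //; apply: (lp_dist HP fV (f := g)).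
Qed.

Lemma local_propI P Q : local_prop P -> local_prop Q ->
  local_prop (fun U => P U /\ Q U).
Proof.
move=> HP HQ; split.
  move=> U W h f e [PU QU].
  by split; [apply: (lp_dist HP h e)|apply: (lp_dist HQ h e)].
move=> x; have [U Ux PU] := lp_ex HP x.
have [f fx Qf] := lp_in HQ Ux.
by exists (dist f) => //; split=> //; apply: (lp_dist HP (@dist_sub _ f)).
Qed.

(** The [g] with [g z] in [N] form an ideal, and a power of [f] belongs to it as
    soon as [z] is in [N] on the distinguished open of [f]. *)
Lemma sub_local0 (M : qcoh S) (N : qsub M) U (z : M U) :
  (forall x, oset U x -> exists W (h : W `<=` U) (f : sO U),
     [/\ oset W = basic f, oset W x & qres h z \in N W]) ->
  z \in N U.
Proof.
move=> H; rewrite -[z]scale1r.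
apply: (ideal_local (affP U) (I := [set g | g *: z \in N U])).
  split=> /= [|a b Na Nb|a b Nb]; first by rewrite scale0r rpred0.
    by rewrite scalerDl rpredD.
  by rewrite -scalerA; apply: smem_scale.
move=> x /H[W [h [f [e Wx Nz]]]].
have [n Nn] := sub_loc e Nz.
by exists (f ^+ n) => //; apply: basicX; rewrite -e.
Qed.

Lemma sub_local P (M : qcoh S) (N : qsub M) U (z : M U) : local_prop P ->
  (forall W (h : W `<=` U) (f : sO U), oset W = basic f -> P W ->
     qres h z \in N W) ->
  z \in N U.
Proof.
move=> HP H; apply: sub_local0 => x Ux; have [f fx Pf] := lp_in HP Ux.
by exists (dist f), (@dist_sub _ f), f; split=> //; apply: (H _ _ f).
Qed.

Lemma eq_local P (M : qcoh S) U (z z' : M U) : local_prop P ->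
  (forall W (h : W `<=` U) (f : sO U), oset W = basic f -> P W ->
     qres h z = qres h z') ->
  z = z'.
Proof.
move=> HP H; apply/eqP; rewrite -subr_eq0.
apply: (@sub_local P M (zero_sub M)) => // W h f e PW.
by rewrite qresB (H _ _ _ e PW) subrr; apply: eqxx.
Qed.

(** Restriction to a smaller affine open [V] is not a localization, but it becomes
    one near each point of [V]. *)
Lemma common_dist U V : V `<=` U -> forall x, oset V x ->
  exists W (h : W `<=` V) (f : sO V), [/\ oset W = basic f, oset W x &
    exists g : sO U, oset W = basic g].
Proof.
move=> h x Vx; have [f [fx [g _ E]]] := common_basic Vx (h _ Vx).
by exists (dist f), (@dist_sub _ f), f; split=> //; exists g.
Qed.

(** A basis of [M] over [O / J]; for [J = 0], a basis of [M]. *)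
Definition frame (J : ideal_sheaf S) r (M : qcoh S) U (e : 'I_r -> M U) :=
  (forall m, exists c : 'I_r -> sO U, m = \sum_i c i *: e i) /\
  (forall c : 'I_r -> sO U, \sum_i c i *: e i = 0 -> forall i, c i \in J U).

Lemma frame_dist (J : ideal_sheaf S) r (M : qcoh S) U W (h : W `<=` U) (f : sO U)
    (e : 'I_r -> M U) :
  oset W = basic f -> frame J e -> frame J (fun i => qres h (e i)).
Proof.
move=> E [gen ind]; split=> [m|c].
  have [d [x ->]] := loc_gen1 h E m.
  have [c ->] := gen x; exists (fun i => d * rres h (c i)).
  rewrite qres_sum scaler_sumr; apply: eq_bigr => i _.
  by rewrite qresZ scalerA.
move=> c0.
(* a common denominator for the coefficients *)
have [n [a Ea]] : exists n (a : 'I_r -> sO U),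
    forall i, rres h f ^+ n * c i = rres h (a i).
  have H i : exists n, exists a : sO U, rres h f ^+ n * c i = rres h a.
    exact: (aff_loc (affP U) h E).1.
  pose n i := sval (cid (H i)).
  have nP i : exists a : sO U, rres h f ^+ n i * c i = rres h a.
    by rewrite /n; case: cid.
  pose N := (\sum_i n i)%N.
  have NP i : exists a : sO U, rres h f ^+ N * c i = rres h a.
    have [a Ea] := nP i; exists (f ^+ (N - n i) * a).
    rewrite rmorphM -Ea rmorphXn mulrA -exprD subnK //.
    by rewrite /N (bigD1 i) //= leq_addr.
  by exists N, (fun i => sval (cid (NP i))) => i; case: cid.
have : qres h (\sum_i a i *: e i) = 0.
  have -> : 0 = rres h f ^+ n *: \sum_i c i *: qres h (e i) by rewrite c0 scaler0.
  rewrite qres_sum scaler_sumr.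
  by apply: eq_bigr => i _; rewrite qresZ -Ea scalerA.
move=> /(qres_loc M h E).2[k Ek] i.
have Ji : f ^+ k * a i \in J U.
  apply: (ind (fun i => f ^+ k * a i)); rewrite -[RHS]Ek scaler_sumr.
  by apply: eq_bigr => i' _; rewrite scalerA.
have := sub_res h Ji; rewrite /= rmorphM -Ea rmorphXn mulrA -exprD => Jc.
have [w Ew] := is_unitX (k + n) (res_unit h E).
have := smem_scale (N := J W) w Jc.
by rewrite /GRing.scale /= mulrA [w * _]mulrC Ew mul1r.
Qed.

Lemma frame_unique r (M : qcoh S) U (e : 'I_r -> M U) (a b : 'I_r -> sO U) :
  frame (zero_sub (OS S)) e ->
  \sum_i a i *: e i = \sum_i b i *: e i -> a =1 b.
Proof.
move=> [_ ind] E i; apply/eqP; rewrite -subr_eq0.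
apply: (ind (fun i => a i - b i)); under eq_bigr do rewrite scalerBl.
by rewrite sumrB E subrr.
Qed.

Lemma locally_free_dist (J : ideal_sheaf S) r (M : qcoh S) :
  locally_free J r M -> local_prop (fun U => exists e : 'I_r -> M U, frame J e).
Proof.
move=> [_ ex]; split=> // U W h f E [e be].
by exists (fun i => qres h (e i)); apply: (frame_dist h E).
Qed.

Lemma cartier_dist (B : cartier S) : local_prop (fun U => exists2 t : sO U,
    (forall a, t * a = 0 -> a = 0) &
    forall b : sO U, b \in B U <-> exists a, b = t * a).
Proof.
split; last exact: cartier_loc.
move=> U W h f E [t reg gen]; exists (rres h t) => [a ta0|b].
  have [n [b Eb]] := (aff_loc (affP U) h E).1 a.
  have /(aff_loc (affP U) h E).2[k] : rres h (t * b) = 0.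
    by rewrite rmorphM -Eb mulrCA ta0 mulr0.
  rewrite mulrCA => /reg Ek.
  have [w Ew] := is_unitX (k + n) (res_unit h E).
  have a0 : rres h f ^+ (k + n) * a = 0.
    by rewrite exprD -mulrA Eb -rmorphXn -rmorphM Ek rmorph0.
  by rewrite -[a]mul1r -Ew mulrAC a0 mul0r.
split=> [Bb|[a ->]].
  have [c [x /gen[a ->] ->]] := loc_gen (M := OS S) h E Bb.
  by exists (c * rres h a); rewrite /GRing.scale /= rmorphM mulrCA.
have Bt : t \in B U by apply/gen; exists 1; rewrite mulr1.
by have := smem_scale (N := B W) a (sub_res h Bt); rewrite /GRing.scale /= mulrC.
Qed.
End Scheme.

Section FiniteGeneration.
Variables (S : scheme) (I : ideal_sheaf S).

(** [b] is a linear combination of the elements of [L], in an impredicative form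
    that makes closure properties immediate. *)
Definition spans (U : aff S) (L : seq (sO U)) (b : sO U) :=
  forall J : set (sO U), is_ideal J -> (forall a, a \in L -> J a) -> J b.

Definition locally_principal := local_prop (fun U : aff S =>
  exists2 t : sO U, t \in I U & forall b : sO U, b \in I U -> exists a, b = t * a).

(** Near each point one section of [I] suffices; finitely many suffice globally
    because the functions on whose nonvanishing locus this is so form an ideal. *)
Lemma principal_fg (U : aff S) : locally_principal ->
  exists2 L : seq (sO U), (forall a : sO U, a \in L -> a \in I U) &
    forall b, b \in I U -> spans L b.
Proof.
move=> HI.
pose Q := [set g : sO U | exists2 L : seq (sO U),
  (forall a : sO U, a \in L -> a \in I U) &
  forall x, basic g x -> forall b, b \in I U ->
  exists2 h, basic h x & spans L (h * b)].
have sub (L L' : seq (sO U)) b : {subset L <= L'} -> spans L b -> spans L' b.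
  by move=> LL' Lb J Jid JL'; apply: Lb => // a /LL'; apply: JL'.
suff [L LI HL] : Q 1.
  exists L => // b Ib.
  have : [set g | spans L (g * b)] 1; last by rewrite /= mul1r.
  apply: (ideal_local (affP U)) => [|x Ux].
    split=> [J [J0 _ _] _|a c Ha Hc J Jid JL|a c Hc J Jid JL] /=.
    - by rewrite mul0r.
    - by rewrite mulrDl; case: (Jid) => _ JD _; apply: JD; [apply: Ha|apply: Hc].
    - by rewrite -mulrA; case: (Jid) => _ _ JM; apply: JM; apply: Hc.
  have [|h hx Hh] := HL x _ b Ib; last by exists h.
  by rewrite basicT //; exists 1; rewrite mulr1.
apply: (ideal_local (affP U)) => [|x Ux].
  split=> [|g g' [L LI HL] [L' LI' HL']|c g [L LI HL]].
  - by exists [::] => // x /(basic0 (affP U)).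
  - exists (L ++ L') => [a|x /(basicD (affP U)) gx b Ib].
      by rewrite mem_cat => /orP[/LI|/LI'].
    case: gx => gx.
      have [h hx Hh] := HL x gx b Ib; exists h => //; apply: sub Hh => a aL.
      by rewrite mem_cat aL.
    have [h hx Hh] := HL' x gx b Ib; exists h => //; apply: sub Hh => a aL.
    by rewrite mem_cat aL orbT.
  - by exists L => // x; rewrite basicM => -[_ gx]; apply: HL.
have [f fx [t It gen]] := lp_in HI Ux.
pose h := @dist_sub S U f.
have [c [t' It' Et]] := loc_gen (M := OS S) h erefl It.
exists f => //; exists [:: t'] => [a|z fz b Ib]; first by rewrite inE => /eqP->.
have [a Ea] := gen _ (sub_res (q := I) h Ib).
have [n [a' Ea']] := (aff_loc (affP U) h erefl).1 (c * a).
have /(aff_loc (affP U) h erefl).2[m Em] : rres h (f ^+ n * b - t' * a') = 0.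
  rewrite rmorphB !rmorphM rmorphXn -Ea' [rres h b]Ea Et /GRing.scale /=.
  by rewrite [rres h t' * _]mulrCA [rres h t' * _]mulrCA -!mulrA subrr.
exists (f ^+ (m + n)) => [|J [_ _ JM] JL]; first exact: basicX.
rewrite exprD -mulrA; have := Em; rewrite mulrBr => /eqP; rewrite subr_eq0 => /eqP->.
by rewrite [t' * _]mulrC mulrA; apply/JM/JL; rewrite inE.
Qed.

(** A linear equation [a x = phi a], with [a] in a locally principal ideal, is
    solvable as soon as it is solvable locally: finitely many [a] suffice, so
    that local solutions extend up to a power of [f], and these form an ideal. *)
Lemma division_local (M : qcoh S) (U : aff S)
    (phi : {linear sub_qcoh I U -> M U}) : locally_principal ->
  (forall x, oset U x -> exists2 f : sO U, basic f x & exists xi : M (dist f),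
     forall a : sub_qcoh I U,
       rres (@dist_sub S U f) (val a) *: xi = qres (@dist_sub S U f) (phi a)) ->
  exists xi : M U, forall a : sub_qcoh I U, (val a : sO U) *: xi = phi a.
Proof.
move=> HI loc; have [L LI HL] := principal_fg U HI.
pose Q := [set g : sO U | exists xi : M U,
  forall a : sub_qcoh I U, (val a : sO U) *: xi = g *: phi a].
suff [xi Hxi] : Q 1 by exists xi => a; rewrite Hxi scale1r.
apply: (ideal_local (affP U)) => [|x /loc[f fx [xi Hxi]]].
  split=> [|g g' [xi H] [xi' H']|c g [xi H]].
  - by exists 0 => a; rewrite scaler0 scale0r.
  - by exists (xi + xi') => a; rewrite scalerDr H H' scalerDl.
  - by exists (c *: xi) => a; rewrite scalerA mulrC -!scalerA H.
pose h := @dist_sub S U f.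
have [n [xi' E]] := (qres_loc M h erefl).1 xi.
pose d (a : sub_qcoh I U) := (val a : sO U) *: xi' - f ^+ n *: phi a.
have d0 a : exists m, f ^+ m *: d a = 0.
  apply: ((qres_loc M h erefl).2 (d a)).
  rewrite qresB !qresZ -E rmorphXn scalerA mulrC -scalerA Hxi.
  by rewrite subrr.
have [m Hm] : exists m, forall a : sub_qcoh I U, (val a : sO U) \in L ->
    f ^+ m *: d a = 0.
  move: LI {HL}; elim: L => [|b L IH] LI; first by exists 0%N.
  have [a aL|m Hm] := IH; first by apply: LI; rewrite inE aL orbT.
  have Ib : b \in I U by apply: LI; rewrite inE eqxx.
  have [k Hk] := d0 (Subm Ib).
  exists (k + m)%N => a; rewrite inE => /orP[/eqP ab|/Hm am].
    have -> : a = Subm Ib by apply: val_inj.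
    by rewrite addnC exprD -scalerA Hk scaler0.
  by rewrite exprD -scalerA am scaler0.
exists (f ^+ (m + n)); last exact: basicX.
exists (f ^+ m *: xi') => a.
pose J := [set b : sO U | exists2 a : sub_qcoh I U, val a = b & f ^+ m *: d a = 0].
suff [a' /val_inj <-] : J (val a).
  move=> /eqP; rewrite scalerBr subr_eq0 => /eqP.
  by rewrite scalerA mulrC -scalerA => ->; rewrite scalerA -exprD.
apply: (HL _ (valP a)) => [|b bL]; last first.
  by exists (Subm (LI b bL)) => //; apply: Hm.
split=> [|b1 b2 [a1 <- H1] [a2 <- H2]|c b1 [a1 <- H1]].
- exists 0; first exact: raddf0.
  by rewrite /d linear0 [phi 0]linear0 scale0r scaler0 subrr scaler0.
- exists (a1 + a2); first exact: raddfD.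
  have -> : d (a1 + a2) = d a1 + d a2.
    by rewrite /d [phi _]linearD raddfD /= scalerDl scalerDr opprD addrACA.
  by rewrite scalerDr H1 H2 addr0.
- exists (c *: a1) => //.
  have -> : d (c *: a1) = c *: d a1.
    rewrite /d [phi _]linearZ /= -scalerA scalerBr; congr (_ - _).
    by rewrite !scalerA mulrC.
  by rewrite scalerA mulrC -scalerA H1 scaler0.
Qed.
End FiniteGeneration.

(** * Modules over an affine open *)

Lemma linear_fun (R : pzRingType) (M N : lmodType R) (f : M -> N) :
  linear f -> exists g : {linear M -> N}, g =1 f.
Proof.
move=> lin; pose m := GRing.isLinear.Build R M N *:%R f lin.
by exists (HB.pack_for {linear M -> N} f m).
Qed.

Lemma free_coord (S : scheme) r (M : qcoh S) (U : aff S) (e : 'I_r -> M U) :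
  frame (zero_sub (OS S)) e ->
  exists psi : 'I_r -> {linear M U -> OS S U},
    forall m, m = \sum_i (psi i m : sO U) *: e i.
Proof.
move=> fe; pose c m := sval (cid (fe.1 m)).
have cE m : m = \sum_i c m i *: e i by rewrite /c; case: cid.
have lin i : linear (fun m : M U => c m i : OS S U).
  move=> a m m'; apply: (frame_unique (b := fun i => a * c m i + c m' i) fe).
  rewrite -cE {1}[m]cE {1}[m']cE scaler_sumr -big_split /=.
  by apply: eq_bigr => j _; rewrite scalerDl scalerA.
pose psi i := sval (cid (linear_fun (lin i))).
exists psi => m; rewrite {1}[m]cE; apply: eq_bigr => i _.
by rewrite /psi; case: cid => g /= ->.
Qed.

Section Restriction.
Variables (S : scheme) (M : qcoh S) (J : ideal_sheaf S) (U : aff S).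

Lemma ideal_mul_mem (a : sO U) (x : M U) : a \in J U -> a *: x \in ideal_mul J M U.
Proof.
move=> Ja; apply/asboolP; exists 1%N, (fun=> a), (fun=> x).
by split=> //; rewrite big_ord1.
Qed.

Lemma rcls_eq (x y : M U) : rcls J x = rcls J y <-> x - y \in ideal_mul J M U.
Proof. exact: qcls_eq. Qed.

Lemma rcls0 (x : M U) : rcls J x = 0 <-> x \in ideal_mul J M U.
Proof. by rewrite -[0](linear0 (rcls J)) rcls_eq subr0. Qed.

Lemma ideal_mul_principal (t : sO U) (x : M U) :
  (forall a, a \in J U -> exists b, a = t * b) ->
  x \in ideal_mul J M U -> exists y, x = t *: y.
Proof.
move=> gen /asboolP[n [a [y [Ja _ ->]]]].
pose b i := sval (cid (gen _ (Ja i))).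
exists (\sum_i b i *: y i); rewrite scaler_sumr; apply: eq_bigr => i _.
by rewrite scalerA /b; case: cid => c /= ->.
Qed.

Lemma tens_ind (N : qcoh S) (T : qtensor M N) (P : T U -> Prop) :
  P 0 -> (forall a x y, P x -> P y -> P (a *: x + y)) ->
  (forall m n, P (tmul T m n)) -> forall t, P t.
Proof.
move=> P0 PD Pm.
pose p : {pred T U} := fun x => `[< P x >].
have pc : submod_closed p.
  by split=> [|a x y /asboolP Px /asboolP Py]; apply/asboolP => //; apply: PD.
pose N' := Submod pc.
have bil : bilin (fun (m : M U) (n : N U) => 0 : quotm N').
  by split=> *; rewrite scaler0 addr0.
have [_ uni] := tens_univ T bil.
move=> t; suff : cls N' t = 0.
  by rewrite -[0](linear0 (cls N')) => /cls_eq; rewrite subr0 => /asboolP.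
apply: (uni (cls N') \0) => m n /=.
by rewrite -[RHS](linear0 (cls N')); apply/cls_eq; rewrite subr0; apply/asboolP/Pm.
Qed.

Lemma tmulZl (N : qcoh S) (T : qtensor M N) (a : sO U) (m : M U) (n : N U) :
  tmul T (a *: m) n = a *: tmul T m n.
Proof.
have [bl _] := tmul_bilin T U.
have e0 : tmul T 0 n = 0.
  by have := bl (-1) 0 0 n; rewrite scaler0 addr0 scaleN1r addNr.
by rewrite -[a *: m]addr0 bl e0 addr0.
Qed.

Lemma tmulZr (N : qcoh S) (T : qtensor M N) (a : sO U) (m : M U) (n : N U) :
  tmul T m (a *: n) = a *: tmul T m n.
Proof.
have [_ br] := tmul_bilin T U.
have e0 : tmul T m 0 = 0.
  by have := br (-1) m 0 0; rewrite scaler0 addr0 scaleN1r addNr.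
by rewrite -[a *: n]addr0 br e0 addr0.
Qed.
End Restriction.

Lemma evZr (S : scheme) (M : qcoh S) (Md : qdual M) (U : aff S) (a : sO U)
  (l : Md U) (m : M U) : ev Md l (a *: m) = a *: ev Md l m.
Proof.
have e0 : ev Md l 0 = 0.
  by have := ev_linr (-1) l 0 0; rewrite scaler0 addr0 scaleN1r addNr.
by rewrite -[a *: m]addr0 ev_linr e0 addr0.
Qed.

Lemma evZl (S : scheme) (M : qcoh S) (Md : qdual M) (U : aff S) (a : sO U)
  (l : Md U) (m : M U) : ev Md (a *: l) m = a *: ev Md l m.
Proof.
have e0 : ev Md 0 m = 0.
  by have := ev_linl (-1) (0 : Md U) 0 m; rewrite scaler0 addr0 scaleN1r addNr.
by rewrite -[a *: l]addr0 ev_linl e0 addr0.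
Qed.

Section QuadraticForms.
Variables (S : scheme) (V M N : qcoh S) (q : qfam V M N) (U : aff S).

Lemma polarC v (x y : M U) : polar (q U) v x y = polar (q U) v y x.
Proof. by rewrite /polar [x + y]addrC addrAC. Qed.

Lemma polarZ v a (x y : M U) : polar (q U) v (a *: x) y = a *: polar (q U) v x y.
Proof.
have p0 : polar (q U) v 0 y = 0.
  by have := qf_polar q v (-1) 0 0 y; rewrite scaler0 addr0 scaleN1r addNr.
by rewrite -[a *: x]addr0 qf_polar p0 addr0.
Qed.

Lemma polar_cls (J : ideal_sheaf S) v (x y : M U) :
  polar (qrestr q J U) (rcls J v) (rcls J x) (rcls J y) = rcls J (polar (q U) v x y).
Proof. by rewrite /polar -linearD !qrestr_cls !linearB. Qed.

Lemma polar_res (W : aff S) (h : W `<=` U) v (x y : M U) :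
  polar (q W) (qres h v) (qres h x) (qres h y) = qres h (polar (q U) v x y).
Proof. by rewrite /polar -qresD !qf_res !qresB. Qed.
End QuadraticForms.

(** * The sections of the Hecke transform *)

Section HeckeTransform.
Variables (S : scheme) (r : nat) (E : qcoh S) (D B : cartier S).
Hypothesis hD : is_double D B.
Variables (K : qsub E|_D) (OB : OofD B) (Et : hecke r B K).
Implicit Types U W : aff S.
Notation j := (hecke_j Et).
Notation inK y := (rcls D y \in K _).

(** What an equation [t] of [B] gives where [Et] is free. *)
Record chart_equation W (t : sO W) : Prop := ChartEquation {
  chart_reg : forall a, t * a = 0 -> a = 0;
  chart_B : forall b : sO W, b \in B W <-> exists a, b = t * a;
  chart_D : forall a : sO W, a \in D W -> exists c, a = t * (t * c);
  chart_regEt : forall x : Et W, t *: x = 0 -> x = 0;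
  chart_div : forall y : E W, inK y -> exists x : Et W, j W y = t *: x }.

Lemma double_principal W (t : sO W) :
  (forall b : sO W, b \in B W <-> exists a, b = t * a) ->
  forall a : sO W, a \in D W <-> exists c, a = t * (t * c).
Proof.
move=> HB a; split=> [/hD/asboolP[n [b [c [Bb Bc ->]]]]|[c ->]].
  have Hb i : exists b' : sO W, b i = t * b' by apply/HB/Bb.
  have Hc i : exists c' : sO W, c i = t * c' by apply/HB/Bc.
  pose b' i := sval (cid (Hb i)); pose c' i := sval (cid (Hc i)).
  exists (\sum_i b' i * c' i); rewrite !mulr_sumr; apply: eq_bigr => i _.
  rewrite /b' /c'; case: cid => b'' /= ->; case: cid => c'' /= ->.
  by rewrite /GRing.scale /= mulrACA -mulrA.
apply/hD/asboolP; exists 1%N, (fun=> t), (fun=> t * c).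
split=> [i|i|]; last by rewrite big_ord1.
  by apply/HB; exists 1; rewrite mulr1.
by apply/HB; exists c.
Qed.

Definition hecke_chart W := (exists2 t : sO W, (forall a, t * a = 0 -> a = 0) &
    forall b : sO W, b \in B W <-> exists a, b = t * a) /\
  exists e : 'I_r -> Et W, frame (zero_sub (OS S)) e.

Lemma hecke_chart_local : local_prop hecke_chart.
Proof. exact: local_propI (cartier_dist B) (locally_free_dist (hecke_bundle Et)). Qed.

(** By definition of the Hecke transform, the coordinates of [j y], for [y] a
    section of the preimage of [K], are functionals that take values in the
    ideal of [B] there, so that [j y] is divisible by an equation of [B]. *)
Lemma hecke_chartP W : hecke_chart W -> exists t, chart_equation (W := W) t.
Proof.
move=> [[t reg HB] [e fe]]; exists t.
have [psi Hpsi] := free_coord fe.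
split=> //.
- by move=> a; apply: (double_principal HB _).1.
- move=> x tx; rewrite [x]Hpsi big1 // => i _.
  suff -> : psi i x = 0 by rewrite scale0r.
  by apply: reg; have := linearZZ (psi i) t x; rewrite tx linear0 => /esym.
move=> y Ky.
have Bpsi i : exists a : sO W, psi i (j W y) = t * a.
  apply/HB; have [H _] := hecke_im Et (psi i \o j W).
  by apply: H Ky; exists (psi i).
pose a i := sval (cid (Bpsi i)).
exists (\sum_i a i *: e i); rewrite [j W y]Hpsi scaler_sumr.
by apply: eq_bigr => i _; rewrite scalerA /a; case: cid => b /= ->.
Qed.

Lemma B_locally_principal : locally_principal B.
Proof.
have [di ex] := cartier_dist B; split.
  move=> U W h f e [t Bt gen]; exists (rres h t); first exact: (sub_res (q := B) h).
  move=> b /(loc_gen (M := OS S) h e)[c [x /gen[a ->] ->]].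
  by exists (c * rres h a); rewrite /GRing.scale /= rmorphM mulrCA.
move=> x; have [U Ux [t _ HB]] := ex x.
exists U => //; exists t => [|b /HB//]; by apply/HB; exists 1; rewrite mulr1.
Qed.

Lemma lmul_lin U (l : OB U) a (y y' : E U) (x x' : Et U) :
  is_lmul l y x -> is_lmul l y' x' -> is_lmul l (a *: y + y') (a *: x + x').
Proof.
move=> H H' b; rewrite linearP !scalerDr H' scalerA mulrC -scalerA H.
by rewrite !scalerA [_ * a]mulrC.
Qed.

Lemma lmul_linl U (l l' : OB U) a (y : E U) (x x' : Et U) :
  is_lmul l y x -> is_lmul l' y x' -> is_lmul (a *: l + l') y (a *: x + x').
Proof.
move=> H H' b; rewrite ev_linl scalerDr H' scalerA mulrC -scalerA H.
by rewrite scalerDl scalerA.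
Qed.

Lemma lmul_res_basic U W (h : W `<=` U) (f : sO U) (l : OB U) y (x : Et U) :
  oset W = basic f -> is_lmul l y x ->
  is_lmul (qres h l) (qres h y) (qres h x).
Proof.
move=> e H a; have [c [a' Ba' Ea]] := loc_gen (M := OS S) h e (valP a).
have -> : a = c *: qres (q := sub_qcoh B) h (Subm Ba') by apply: val_inj; rewrite Ea.
rewrite evZr ev_res hom_res -[RHS]scalerA -qresZ -H.
by rewrite /= -scalerA qresZ.
Qed.

(** Localization describes the ideal of [B] over [W] by restrictions from [U] only
    where [W] is replaced by a distinguished open of [U]. *)
Lemma lmul_res U W (h : W `<=` U) (l : OB U) y (x : Et U) :
  is_lmul l y x -> is_lmul (qres h l) (qres h y) (qres h x).
Proof.
move=> H a; apply/eqP; rewrite -subr_eq0.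
apply: (@sub_local0 _ _ (zero_sub Et)) => z Wz.
have [T [k [f [e Tz [g e']]]]] := common_dist h Wz; exists T, k, f; split=> //.
pose hk : T `<=` U := subset_trans k h.
apply/eqP; rewrite qresB !qresZ -hom_res !(qres_comp h k hk).
rewrite (lmul_res_basic hk e' H (qres k a)) -(qres_comp h k hk l).
by rewrite ev_res subrr.
Qed.

(** For a section [y] of the preimage of [K], [l (x) y] lies in [Et]; locally,
    it is the product of [l t] and of the quotient of [j y] by [t]. *)
Lemma lmul_exists U (l : OB U) (y : E U) : inK y ->
  exists x : Et U, is_lmul l y x.
Proof.
move=> Ky.
have lin : linear (fun a : sub_qcoh B U => (ev OB l a : sO U) *: j U y).
  by move=> a b c; rewrite ev_linr scalerDl scalerA.
have [phi phiE] := linear_fun lin.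
have [|x Hx] := division_local (phi := phi) B_locally_principal; last first.
  by exists x => a; rewrite Hx phiE.
move=> x Ux; have [f fx sf] := lp_in hecke_chart_local Ux; exists f => //.
have [t [reg HB _ _ dv]] := hecke_chartP sf.
pose h := @dist_sub S U f.
have [|xi Exi] := dv (qres h y); first by rewrite -rcls_res; apply: sub_res.
have Bt : t \in B (dist f) by apply/HB; exists 1; rewrite mulr1.
exists ((ev OB (qres h l) (Subm Bt) : sO (dist f)) *: xi) => a.
have [c Ec] := (HB _).1 (valP (qres h a)).
rewrite phiE qresZ -hom_res Exi.
have -> : rres h (ev OB l a) = c * ev OB (qres h l) (Subm Bt).
  rewrite -[LHS](ev_res h l).
  have -> : qres h a = c *: Subm Bt.
    by apply: val_inj; rewrite /= -/(qres h a) [LHS]Ec mulrC.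
  by rewrite evZr.
have -> : rres h (val a) = t * c by exact: Ec.
by rewrite !scalerA [t * c]mulrC mulrAC.
Qed.


Lemma lift_K U (kap : sub_qcoh K U) : exists2 y : E U, rcls D y = val kap & inK y.
Proof. by exists (qrep (val kap)); rewrite rrepK //; apply: (valP kap). Qed.

Lemma hom_ideal_mul (M N : qcoh S) (J : ideal_sheaf S) (f : qhom M N) U x :
  x \in ideal_mul J M U -> f U x \in ideal_mul J N U.
Proof.
move=> /asboolP[n [a [z [Ja _ ->]]]]; apply/asboolP.
exists n, a, (fun i => f U (z i)); split=> //.
by rewrite linear_sum; apply: eq_bigr => i _; rewrite linearZ.
Qed.

(** Where [B] has the equation [t], [y] is a multiple of [t ^ 2], so that its
    quotient by [t] is still a multiple of [t]. *)
Lemma lmul_zero U (l : OB U) (y : E U) (x : Et U) :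
  rcls D y = 0 -> is_lmul l y x -> rcls B x = 0.
Proof.
move=> /rcls0 y0 H; apply/rcls0; apply: (sub_local hecke_chart_local) => W h f e sW.
have [t [_ HB HD reg _]] := hecke_chartP sW.
have Bt : t \in B W by apply/HB; exists 1; rewrite mulr1.
have [w Ew] : exists w, qres h y = (t * t) *: w.
  apply: (ideal_mul_principal (J := D)); last exact: (sub_res h y0).
  by move=> a /HD[c ->]; exists c; rewrite mulrA.
have := lmul_res h H (Subm Bt).
rewrite Ew linearZ /= -[(t * t) *: _]scalerA scalerA [_ * t]mulrC -scalerA => /eqP.
rewrite -subr_eq0 -scalerBr => /eqP/reg/eqP; rewrite subr_eq0 => /eqP->.
by rewrite scalerA mulrC -scalerA; apply: ideal_mul_mem.
Qed.

(** A section of [K] that vanishes on [B] is a combination of sections of [K] with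
    coefficients in the ideal of [B], and the sections [l (x) y] of [Et] for their
    lifts show that the corresponding [x] is divisible likewise. *)
Lemma lmul_zeroB U (l : OB U) (kap : sub_qcoh K U) (y : E U) (x : Et U) :
  rcls B kap = 0 -> rcls D y = val kap -> is_lmul l y x -> rcls B x = 0.
Proof.
move=> /rcls0/asboolP[n [a [k [Ba _ ->]]]]; elim: n a k Ba y x => [|n IH] a k Ba y x.
  by rewrite big_ord0 linear0; apply: lmul_zero.
rewrite big_ord_recl => Hy Hx.
have [y1 Hy1 /(lmul_exists l)[x1 Hx1]] := lift_K (k ord0).
have Hxx : rcls B (- a ord0 *: x1 + x) = 0.
  apply: IH (fun i => Ba (lift ord0 i)) _ _ _ (lmul_lin (- a ord0) Hx1 Hx).
  rewrite linearP Hy1 Hy raddfD /= scaleNr.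
  by rewrite addrA addNr add0r.
have -> : x = a ord0 *: x1 + (- a ord0 *: x1 + x).
  by rewrite addrA -scalerDl subrr scale0r add0r.
rewrite linearD Hxx addr0.
by apply/rcls0/ideal_mul_mem/Ba.
Qed.

Variable KB : qtensor (sub_qcoh K)|_B OB.

(** The class of [l (x) y] in [Et|_B] depends bilinearly on [l] and on the section
    of [K|_B] that [y] lifts, by the two preceding vanishing statements. *)
Lemma splitting_affine U : exists g : {linear KB U -> Et|_B U},
  forall (l : OB U) (y : E U) (kap : sub_qcoh K U) (x : Et U),
  rcls D y = val kap -> is_lmul l y x ->
  g (tmul KB (rcls B kap) l) = rcls B x.
Proof.
have H (k : (sub_qcoh K)|_B U) (l : OB U) : exists x : Et U,
    is_lmul l (qrep (val (qrep k))) x.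
  by apply: lmul_exists; rewrite rrepK; apply: valP.
pose b k l : Et|_B U := rcls B (sval (cid (H k l))).
have bE (l : OB U) (y : E U) (kap : sub_qcoh K U) (x : Et U) :
    rcls D y = val kap -> is_lmul l y x ->
    b (rcls B kap) l = rcls B x.
  rewrite /b; case: cid => x' /= Hx' Hy Hx; apply/eqP; rewrite -subr_eq0 -linearB.
  have := lmul_lin (-1) Hx Hx'; rewrite !scaleN1r ![- _ + _]addrC => Hxx.
  apply/eqP; apply: (@lmul_zeroB _ _ (qrep (rcls B kap) - kap) _ _ _ _ Hxx).
    by rewrite linearB rrepK subrr.
  by rewrite linearB rrepK [rcls D y]Hy.
have bil : bilin b.
  split=> [c k k' l|c k l l'].
    rewrite -[k]rrepK -[k']rrepK -linearP.
    have [y Hy /(lmul_exists l)[x Hx]] := lift_K (qrep k).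
    have [y' Hy' /(lmul_exists l)[x' Hx']] := lift_K (qrep k').
    rewrite (bE _ _ _ _ Hy Hx) (bE _ _ _ _ Hy' Hx') -linearP.
    by apply: bE (lmul_lin c Hx Hx'); rewrite linearP Hy Hy'.
  rewrite -[k]rrepK.
  have [y Hy Ky] := lift_K (qrep k).
  have [x Hx] := lmul_exists l Ky; have [x' Hx'] := lmul_exists l' Ky.
  rewrite (bE _ _ _ _ Hy Hx) (bE _ _ _ _ Hy Hx') -linearP.
  exact: bE (lmul_linl c Hx Hx').
have [[g gE] _] := tens_univ KB bil.
by exists g => l y kap x Hy Hx; rewrite gE (bE _ _ _ _ Hy Hx).
Qed.

Lemma splitting_exists : exists s : qhom KB Et|_B, canonical_splitting s.
Proof.
pose s U := sval (cid (splitting_affine U)).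
have sE U (l : OB U) (y : E U) (kap : sub_qcoh K U) (x : Et U) :
    rcls D y = val kap -> is_lmul l y x ->
    s U (tmul KB (rcls B kap) l) = rcls B x.
  by rewrite /s; case: cid => g /= gE; apply: gE.
have sres U W (h : W `<=` U) t : s W (qres h t) = qres h (s U t).
  move: t; apply: tens_ind => [|a t t' Ht Ht'|k l].
  - by rewrite qres0 !linear0 qres0.
  - by rewrite qres_lin !linearP Ht Ht' qres_lin.
  have [y Hy Ky] := lift_K (qrep k); have [x Hx] := lmul_exists l Ky.
  rewrite -[k]rrepK (sE _ _ _ _ _ Hy Hx) -tmul_res !rcls_res.
  apply: sE (lmul_res h Hx).
  by rewrite -rcls_res Hy.
by exists (Defs.Hom sres) => U l y kap x; apply: sE.
Qed.

Lemma splitting_unique (s s' : qhom KB Et|_B) :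
  canonical_splitting s -> canonical_splitting s' -> forall U t, s U t = s' U t.
Proof.
move=> Hs Hs' U; apply: tens_ind => [|a t t' Ht Ht'|k l].
- by rewrite !linear0.
- by rewrite !linearP Ht Ht'.
have [y Hy Ky] := lift_K (qrep k); have [x Hx] := lmul_exists l Ky.
by rewrite -[k]rrepK (Hs _ _ _ _ _ Hy Hx) (Hs' _ _ _ _ _ Hy Hx).
Qed.

(** Locally [j y] is divisible by the equation of [B]. *)
Lemma j_inK U (y : E U) : inK y -> rcls B (j U y) = 0.
Proof.
move=> Ky; apply/rcls0; apply: (sub_local hecke_chart_local) => W h f e sW.
have [t [_ HB _ _ dv]] := hecke_chartP sW.
have Bt : t \in B W by apply/HB; exists 1; rewrite mulr1.
have [|x] := dv (qres h y); first by rewrite -rcls_res; apply: sub_res.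
by rewrite hom_res => ->; apply: ideal_mul_mem.
Qed.

Lemma quotient_map : exists i : qhom (quot (sub_restr B K)) Et|_B,
  forall U (y : E U), i U (qcls (sub_restr B K) U (rcls B y)) = rcls B (j U y).
Proof.
pose i U (z : quot (sub_restr B K) U) : Et|_B U := rcls B (j U (qrep (qrep z))).
have iE U y : i U (qcls (sub_restr B K) U (rcls B y)) = rcls B (j U y).
  rewrite /i; set z := qcls _ _ _; apply/eqP; rewrite -subr_eq0 -!linearB.
  have : qcls (sub_restr B K) U (rcls B (qrep (qrep z))) = z.
    by rewrite rrepK qrepK.
  move=> /qcls_eq; rewrite -linearB => /asboolP[y' Ky' /rcls_eq].
  set w := _ - y.
  move=> /(hom_ideal_mul j)/rcls0; rewrite !linearB /= (j_inK Ky') subr0.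
  by move=> ->.
have lin U : linear (i U).
  move=> a z z'; rewrite -[z]qrepK -[z']qrepK -[qrep z]rrepK -[qrep z']rrepK.
  move: (qrep (qrep z)) (qrep (qrep z')) => y y'.
  transitivity (i U (qcls (sub_restr B K) U (rcls B (a *: y + y')))).
    by rewrite !linearP.
  by rewrite !iE !linearP.
pose g U := sval (cid (linear_fun (lin U))).
have gE U z : g U z = i U z by rewrite /g; case: cid => g' /= ->.
have gres U W (h : W `<=` U) z : g W (qres h z) = qres h (g U z).
  rewrite !gE -[z]qrepK -[qrep z]rrepK qcls_res rcls_res !iE rcls_res.
  by rewrite hom_res.
by exists (Defs.Hom gres) => U y; rewrite /= gE iE.
Qed.

Variables (p : qhom Et KB) (hp : hecke_proj p).

Lemma proj_ideal U (x : Et U) : x \in ideal_mul B Et U -> p U x = 0.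
Proof.
move=> /asboolP[n [a [z [Ba _ ->]]]]; rewrite linear_sum big1 // => i _.
rewrite linearZ /=; move: (p U (z i)); apply: tens_ind => [|c t t' Ht Ht'|k l].
- by rewrite scaler0.
- by rewrite scalerDr scalerA mulrC -scalerA Ht Ht' scaler0 addr0.
rewrite -tmulZl; have -> : a i *: k = 0.
  by rewrite -[k]rrepK -linearZ; apply/rcls0/ideal_mul_mem.
by rewrite -(scale0r (0 : (sub_qcoh K)|_B U)) tmulZl scale0r.
Qed.

(** Elements of the second summand have representatives [x] such that [B x] lies in
    the preimage of [K]: for [x] equal to [l (x) y], the product [a x] is the image
    of [l(a) y], and the property passes to linear combinations. *)
Lemma splitting_lift (s : qhom KB Et|_B) : canonical_splitting s ->
  forall U (t : KB U), exists x : Et U,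
  [/\ p U x = t, s U t = rcls B x &
    forall a : sub_qcoh B U, exists2 y, inK y & (val a : sO U) *: x = j U y].
Proof.
move=> Hs U; apply: tens_ind => [|c t t' [x [Ex Es Hx]] [x' [Ex' Es' Hx']]|k l].
- exists 0; split; rewrite ?linear0 // => a; exists 0.
    by rewrite linear0 rpred0.
  by rewrite scaler0 linear0.
- exists (c *: x + x'); split; rewrite ?linearP /= ?Ex ?Ex' ?Es ?Es' // => a.
  have [y Ky Ey] := Hx a; have [y' Ky' Ey'] := Hx' a.
  exists (c *: y + y'); first by rewrite linearP rpredD //; apply: smem_scale.
  by rewrite linearP -Ey -Ey' scalerDr !scalerA mulrC.
have [y Hy Ky] := lift_K (qrep k); have [x Hx] := lmul_exists l Ky.
exists x; rewrite -[k]rrepK (Hs _ _ _ _ _ Hy Hx) (hproj_lmul hp Hy Hx).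
split=> // a; exists (ev OB l a *: y); last by rewrite linearZ /= Hx.
by rewrite linearZ; apply: smem_scale.
Qed.

Lemma splitting_section (s : qhom KB Et|_B) : canonical_splitting s ->
  forall U (t : KB U) (x : Et U), s U t = rcls B x -> p U x = t.
Proof.
move=> Hs U t x Ex; have [x' [Ex' Es _]] := splitting_lift Hs t; rewrite -Ex'.
apply/eqP; rewrite -subr_eq0 -linearB; apply/eqP/proj_ideal.
by apply/rcls_eq; rewrite -Ex.
Qed.

(** The converse of [j_inK], up to sections of [B E]: if [j y = t x], write
    [x = x' + j y2] with [x'] a lift as in [splitting_lift]; then [t x' = j y1] with
    [y1] in the preimage of [K], so [y = y1 + t y2] by injectivity of [j]. *)
Lemma j_ideal U (y : E U) : rcls B (j U y) = 0 -> rcls B y \in sub_restr B K U.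
Proof.
have [s Hs] := splitting_exists.
move=> /rcls0 y0; apply: (sub_local hecke_chart_local) => W h f e sW.
have [t [_ HB _ reg _]] := hecke_chartP sW.
have Bt : t \in B W by apply/HB; exists 1; rewrite mulr1.
have [|x Ex] := ideal_mul_principal (x := j W (qres h y)) (fun b => (HB b).1).
  by rewrite hom_res; apply: sub_res.
have [x' [Ex' _ Hx']] := splitting_lift Hs (p W x).
have [y1 Ky1 Ey1] := Hx' (Subm Bt).
have [|y2 Ey2] := (hproj_ker hp (x - x')).1; first by rewrite linearB Ex' subrr.
rewrite rcls_res; apply/asboolP; exists y1 => //.
apply/rcls_eq; suff -> : qres h y - y1 = t *: y2 by apply: ideal_mul_mem.
apply: (hproj_inj hp); rewrite linearB linearZ /= -Ey2 Ex -Ey1 scalerBr.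
by [].
Qed.
End HeckeTransform.

(** * Lines extending to bases *)

Lemma det_cong (R : comPzRingType) (I : set R) n (M N : 'M[R]_n) :
  is_ideal I -> (forall i j, I (M i j - N i j)) -> I (\det M - \det N).
Proof.
move=> [I0 ID IM] H; rewrite /determinant.
have dM (a b c d : R) : I (a - b) -> I (c - d) -> I (a * c - b * d).
  move=> Hab Hcd; have -> : a * c - b * d = c * (a - b) + b * (c - d).
    by rewrite !mulrBr [c * a]mulrC [c * b]mulrC addrA subrK.
  by apply: ID; apply: IM.
apply: (big_ind2 (fun a b => I (a - b))) => [|a b c d Hab Hcd|s _].
- by rewrite subrr.
- by rewrite opprD addrACA; apply: ID.
rewrite -mulrBr; apply: (IM).
apply: (big_ind2 (fun a b => I (a - b))) => [|a b c d|i _ //].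
  by rewrite subrr.
exact: dM.
Qed.

Section Extension.
Variables (S : scheme) (U : aff S).

Lemma sum_comb r (M : qcoh S) (b : 'I_r -> M U) (e : 'I_r -> M U)
    (Q : 'M[sO U]_r) (c : 'I_r -> sO U) :
  (forall k, e k = \sum_j Q k j *: b j) ->
  \sum_k c k *: e k = \sum_j ((\row_k c k *m Q) 0 j) *: b j.
Proof.
move=> eE.
under eq_bigr do rewrite eE scaler_sumr.
rewrite exchange_big /=; apply: eq_bigr => j _; rewrite mxE scaler_suml.
by apply: eq_bigr => k _; rewrite mxE scalerA.
Qed.

(** The inverse of [Q] is the adjugate matrix divided by the determinant. *)
Lemma frame_change r (M : qcoh S) (b : 'I_r -> M U) (e : 'I_r -> M U)
    (Q : 'M[sO U]_r) :
  frame (zero_sub (OS S)) b -> (forall k, e k = \sum_j Q k j *: b j) ->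
  is_unit (\det Q) ->
  forall x, exists! c : {ffun 'I_r -> sO U}, x = \sum_i c i *: e i.
Proof.
move=> fb eE [d Ed] x; pose R := d *: \adj Q.
have QR : Q *m R = 1%:M by rewrite -scalemxAr mul_mx_adj scale_scalar_mx mulrC Ed.
have RQ : R *m Q = 1%:M by rewrite -scalemxAl mul_adj_mx scale_scalar_mx mulrC Ed.
have [a Ea] := fb.1 x.
pose c := \row_j a j *m R.
exists [ffun i => c 0 i]; split.
  rewrite (sum_comb _ eE) Ea; apply: eq_bigr => j _; congr (_ *: _).
  have -> : \row_k [ffun i => c 0 i] k = c by apply/rowP => k; rewrite !mxE ffunE mxE.
  by rewrite -mulmxA RQ mulmx1 mxE.
move=> c'; rewrite (sum_comb _ eE) Ea => /(frame_unique fb) E.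
apply/ffunP => i; rewrite ffunE /c.
have -> : \row_j a j = \row_k c' k *m Q by apply/rowP => k; rewrite mxE E.
by rewrite -mulmxA QR mulmx1 mxE.
Qed.
End Extension.

(** Lift a generator of [K] and a frame of the quotient to [E]. At a point of [D]
    the matrix of the lifts in a frame of [E] is invertible modulo [D], hence its
    determinant does not vanish there. *)
Lemma extension_frame (S : scheme) (J : ideal_sheaf S) r (E : qcoh S)
    (K : qsub E|_J) (U : aff S) (x : S) (b : 'I_r -> E U) (e0 : E U)
    (kap : sub_qcoh K U) :
  oset U x -> (forall a : sO U, a \in J U -> ~ basic a x) ->
  frame (zero_sub (OS S)) b -> rcls J e0 = val kap ->
  (forall k, exists a : sO U, k = a *: kap) ->
  (forall a : sO U, a *: kap = 0 -> a \in J U) ->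
  (exists c : 'I_r.-1 -> quot K U, forall m, exists a : 'I_r.-1 -> sO U,
     m = \sum_i a i *: c i) ->
  exists (e : 'I_r -> E U) (Q : 'M[sO U]_r),
    [/\ exists i, e0 = e i, forall k, e k = \sum_j Q k j *: b j & basic (\det Q) x].
Proof.
move=> Ux Jx fb Ee0 genK indK [c genc]; case: r b fb c genc => [|r'] b fb c genc.
  (* on a bundle of rank 0, [K] has a basis vector only where [J] is everything *)
  exfalso; apply: (Jx 1); last by rewrite basicT //; exists 1; rewrite mulr1.
  apply: indK; rewrite scale1r; apply: val_inj; rewrite -Ee0.
  by have [a ->] := fb.1 e0; rewrite big_ord0 linear0.
pose e (i : 'I_r'.+1) := if unlift ord0 i is Some k then qrep (qrep (c k)) else e0.
have e_0 : e ord0 = e0 by rewrite /e unlift_none.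
have e_lift k : e (lift ord0 k) = qrep (qrep (c k)) by rewrite /e liftK.
have gen m : exists a : 'I_r'.+1 -> sO U,
    m - \sum_i a i *: e i \in ideal_mul J E U.
  have [a Ea] := genc (qcls K U (rcls J m)).
  have Km : rcls J (m - \sum_i a i *: e (lift ord0 i)) \in K U.
    rewrite linearB linear_sum; apply/qcls_eq; rewrite Ea linear_sum.
    apply: eq_bigr => i _.
    have -> : c i = qcls K U (rcls J (e (lift ord0 i))) by rewrite e_lift rrepK qrepK.
    by rewrite !linearZ.
  have [a0 Ea0] := genK (Subm Km).
  exists (fun i => if unlift ord0 i is Some k then a k else a0).
  rewrite big_ord_recl unlift_none e_0.
  under eq_bigr do rewrite liftK.
  apply/rcls0; rewrite opprD addrA addrAC linearB [rcls J (m - _)](congr1 val Ea0).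
  by rewrite [rcls J (_ *: _)]linearZ [rcls J e0]Ee0 subrr.
have Hb i : exists a : 'I_r'.+1 -> sO U, b i - \sum_k a k *: e k \in ideal_mul J E U.
  exact: gen.
pose P := \matrix_(i, k) sval (cid (Hb i)) k.
have PE i : b i - \sum_k P i k *: e k \in ideal_mul J E U.
  by under eq_bigr do rewrite mxE; case: cid.
have He k : exists a : 'I_r'.+1 -> sO U, e k = \sum_j a j *: b j by exact: fb.1.
pose Q := \matrix_(k, j) sval (cid (He k)) j.
have QE k : e k = \sum_j Q k j *: b j by under eq_bigr do rewrite mxE; case: cid.
exists e, Q; split=> //; first by exists ord0.
(* modulo [J], the matrices [P] and [Q] are inverse to each other *)
have JE m : m \in ideal_mul J E U -> exists2 a : 'I_r'.+1 -> sO U,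
    (forall j, a j \in J U) & m = \sum_j a j *: b j.
  move=> /asboolP[n [a [y [Ja _ ->]]]].
  apply: (big_ind (fun m => exists2 a : 'I_r'.+1 -> sO U,
    (forall j, a j \in J U) & m = \sum_j a j *: b j)) => [|m1 m2|i _].
  - exists (fun=> 0) => [j|]; first exact: rpred0.
    by rewrite big1 // => j _; rewrite scale0r.
  - move=> [a1 J1 ->] [a2 J2 ->]; exists (fun j => a1 j + a2 j) => [j|].
      by apply: rpredD.
    by rewrite -big_split; apply: eq_bigr => j _; rewrite scalerDl.
  have [d ->] := fb.1 (y i); exists (fun j => d j * a i) => [j|].
    exact: (smem_scale (N := J U)).
  by rewrite scaler_sumr; apply: eq_bigr => j _; rewrite scalerA mulrC.
have PQ i j : (1%:M - P *m Q) i j \in J U.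
  have [a Ja Ea] := JE _ (PE i); rewrite mxE [in X in _ + X]mxE.
  suff <- : a j = 1%:M i j - (P *m Q) i j by apply: Ja.
  apply: (frame_unique fb (a := a) (b := fun j => 1%:M i j - (P *m Q) i j)).
  rewrite -Ea; under [RHS]eq_bigr do rewrite scalerBl.
  rewrite sumrB; congr (_ - _).
    rewrite (bigD1 i) //= big1 ?addr0 => [|j' ne]; first by rewrite mxE eqxx scale1r.
    by rewrite mxE eq_sym (negbTE ne) scale0r.
  rewrite (sum_comb _ QE); apply: eq_bigr => j' _; congr (_ *: _).
  by rewrite !mxE; apply: eq_bigr => k _; rewrite !mxE.
apply: contrapT => nQ.
have [p0 p1 pD pM pP] := aff_prime (affP U) Ux.
apply: p1; have -> : 1 = (\det (1%:M : 'M[sO U]_r'.+1) - \det (P *m Q)) + \det (P *m Q).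
  by rewrite det1 subrK.
apply: (pD); last by rewrite det_mulmx; apply: (pM) nQ.
apply: (det_cong (I := prime_at x)); first by split.
by move=> i j; have := PQ i j; rewrite mxE [in X in _ + X]mxE => /Jx.
Qed.

(** * The residual family *)

Section Proposition.
Variables (S : scheme) (r : nat) (E V : qcoh S) (D B : cartier S).
Hypotheses (hE : vector_bundle r E) (hD : is_double D B).
Variables (K : qsub E|_D) (OB : OofD B) (OD : OofD D) (Et : hecke r B K).
Hypothesis hK : line_subbundle D r K.
Implicit Types U W : aff S.

(** Near a point outside [D], the equation of [B] becomes a unit. *)
Lemma extension_near U x : oset U x -> exists W (h : W `<=` U) (f : sO U),
  [/\ oset W = basic f, oset W x, hecke_chart Et W &
    (1 : sO W) \in B W \/
    exists (e : E W) (kap : sub_qcoh K W), local_extension r e kap].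
Proof.
move=> Ux; have HP := local_propI (hecke_chart_local Et) (local_propI
  (locally_free_dist hE) (local_propI (locally_free_dist hK.1) (locally_free_dist hK.2))).
have [f fx [sW [[b fb] [[k0 fk] [c fc]]]]] := lp_in HP Ux.
have shrink (g : sO (dist f)) : exists f' : sO U, oset (dist g) = basic f'.
  by have [f' _ e] := basic_lift (affP U) (@dist_sub _ U f) erefl g; exists f'.
have hW (g : sO (dist f)) : dist g `<=` U.
  by apply: subset_trans (dist_sub (f := f)); apply: dist_sub.
have [t [reg HB HD _ _]] := hecke_chartP hD sW.
case: (pselect (basic t x)) => [tx|ntx].
  have [f' e'] := shrink t; exists (dist t), (hW t), f'; split=> //.
    exact: (lp_dist (hecke_chart_local Et) (@dist_sub _ _ t)) sW.
  left; have [w Ew] := res_unit (@dist_sub _ _ t) erefl.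
  have Bt : t \in B (dist f) by apply/HB; exists 1; rewrite mulr1.
  have := smem_scale (N := B (dist t)) w (sub_res (@dist_sub _ _ t) Bt).
  by rewrite /GRing.scale /= mulrC Ew.
have Dx a : a \in D (dist f) -> ~ basic a x.
  by move=> /HD[c' ->]; rewrite basicM => -[].
have genK k : exists a : sO (dist f), k = a *: k0 ord0.
  by have [a ->] := fk.1 k; exists (a ord0); rewrite big_ord1.
have Ee0 := rrepK (val (k0 ord0)).
have indK (a : sO (dist f)) : a *: k0 ord0 = 0 -> a \in D (dist f).
  by move=> a0; apply: (fk.2 (fun=> a) _ ord0); rewrite big_ord1.
have Wx : oset (dist f) x by [].
have [|e [Q [[i ei] QE Qx]]] := extension_frame Wx Dx fb Ee0 genK indK.
  by exists c; apply: fc.1.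
have [f' e'] := shrink (\det Q); set h := @dist_sub _ _ (\det Q).
exists (dist (\det Q)), (hW _), f'; split=> //.
  exact: (lp_dist (hecke_chart_local Et) h) sW.
right; exists (qres h (qrep (val (k0 ord0)))), (qres h (k0 ord0)); split.
- exists (fun i => qres h (e i)); last by exists i; rewrite ei.
  apply: (frame_change (Q := map_mx (rres h) Q) (frame_dist h erefl fb)) => [k|].
    by rewrite QE qres_sum; apply: eq_bigr => j _; rewrite qresZ mxE.
  by rewrite det_map_mx; apply: res_unit.
- by rewrite -rcls_res Ee0.
move=> kap; have [a [k' ->]] := loc_gen1 h erefl kap.
by have [a' ->] := genK k'; exists (a * rres h a'); rewrite qresZ scalerA.
Qed.

(** The generator is the functional that divides by [u]. *)
Lemma dual_generator (J : ideal_sheaf S) (Jd : qdual (sub_qcoh J)) W (u : sO W) :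
  (forall a, u * a = 0 -> a = 0) ->
  (forall a : sO W, a \in J W -> exists c, a = u * c) ->
  exists l : Jd W, forall a : sub_qcoh J W, u * (ev Jd l a : sO W) = val a.
Proof.
move=> reg gen.
have H (a : sub_qcoh J W) : exists c : sO W, val a = u * c by apply/gen/valP.
pose phi a : OS S W := sval (cid (H a)).
have phiE a : u * (phi a : sO W) = val a by rewrite /phi; case: cid.
have lin : linear phi.
  move=> c a b; apply/eqP; rewrite -subr_eq0; apply/eqP/reg.
  rewrite mulrBr phiE mulrDr phiE.
  by rewrite /GRing.scale /= mulrCA phiE subrr.
have [g gE] := linear_fun lin.
have [l [lE _]] := ev_perfect Jd g.
by exists l => a; rewrite lE gE phiE.
Qed.

Lemma dual_unique (J : ideal_sheaf S) (Jd : qdual (sub_qcoh J)) W (l l' : Jd W) :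
  (forall a, ev Jd l a = ev Jd l' a) -> l = l'.
Proof.
move=> H; have lin : linear (ev Jd l : sub_qcoh J W -> OS S W).
  by move=> a x y; rewrite ev_linr.
have [g gE] := linear_fun lin.
have [l0 [_ uni]] := ev_perfect Jd g.
by rewrite -(uni l) => [|a]; rewrite ?gE //; apply: uni => a; rewrite gE.
Qed.

Variables (q : qfam V E (OS S)) (qt : qfam V Et (OS S)) (hqt : hecke_qfam q qt).

Lemma hecke_polar U (v : V U) (x y : E U) :
  polar (qt U) v (hecke_j Et U x) (hecke_j Et U y) = polar (q U) v x y.
Proof. by rewrite /polar -linearD !hqt. Qed.

Variables (KB : qtensor (sub_qcoh K)|_B OB) (VD : qtensor V OD).

(** [t polar(j y, x) = polar(y, t x)] vanishes on [D], that is, modulo [t ^ 2]. *)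
Lemma splitting_orthogonal (p : qhom Et KB) (i : qhom (quot (sub_restr B K)) Et|_B)
    (s : qhom KB Et|_B) :
  in_kernel K q -> hecke_proj p -> canonical_splitting s ->
  (forall U (y : E U),
     i U (qcls (sub_restr B K) U (rcls B y)) = rcls B (hecke_j Et U y)) ->
  forall U (v : V|_B U) (z : quot (sub_restr B K) U) (t : KB U),
    polar (qrestr qt B U) v (i U z) (s U t) = 0.
Proof.
move=> hker hp Hs Hi U v z t0; apply: (eq_local (hecke_chart_local Et)) => W h f e sW.
rewrite qres0 -polar_res -!hom_res.
move: (qres h v) (qres h z) (qres h t0) => {e v z t0} v z t0.
have [x [_ -> Hx]] := splitting_lift hD hp Hs t0.
rewrite -[z]qrepK -[qrep z]rrepK Hi -[v]rrepK polar_cls.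
move: (qrep v) (qrep (qrep z)) => {v z} v y.
have [t [reg HB HD _ _]] := hecke_chartP hD sW.
have Bt : t \in B W by apply/HB; exists 1; rewrite mulr1.
have [y' Ky' Ey'] := Hx (Subm Bt).
have : rcls D (polar (q W) v y y') = 0 by rewrite -polar_cls; apply: hker.
move=> /rcls0/(ideal_mul_principal (t := t * t))[a /HD[c ->]|c Ec].
  by exists c; rewrite mulrA.
apply/rcls0; suff -> : polar (qt W) v (hecke_j Et W y) x = t *: (c : OS S W).
  exact: ideal_mul_mem.
apply/eqP; rewrite -subr_eq0; apply/eqP/reg; rewrite mulrBr.
have -> : t * polar (qt W) v (hecke_j Et W y) x = polar (q W) v y y'.
  by rewrite -hecke_polar -Ey' polarC -[LHS]polarZ polarC.
by rewrite Ec /GRing.scale /= mulrA subrr.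
Qed.

Variables (rho : qfam VD|_D (sub_qcoh K) (OS S)|_D) (hrho : residual r q rho).
Variables (rhoB : qfam V|_B KB (OS S)|_B) (hrhoB : residual_restr rho rhoB).

(** If [l] and [d] are the generators of [O(B)] and [O(D)] dual to [t] and [t ^ 2],
    both sides send [v] and [kap (x) l] to the class of [qt v (l (x) e)], because
    [q v e = t ^ 2 qt v (l (x) e)]. *)
Lemma residual_splitting W (s : qhom KB Et|_B) (e : E W) (kap : sub_qcoh K W) :
  canonical_splitting s -> hecke_chart Et W -> local_extension r e kap ->
  forall (v : V|_B W) (t : KB W), qrestr qt B W v (s W t) = rhoB W v t.
Proof.
move=> Hs sW ext v t0; have [_ ee gen] := ext.
have [t [reg HB HD _ dv]] := hecke_chartP hD sW.
have tB a : a \in B W -> exists c, a = t * c by move=> /HB.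
have [l lE] := dual_generator OB reg tB.
have [d dE] : exists d : OD W, forall a : sub_qcoh D W,
    t * t * (ev OD d a : sO W) = val a.
  apply: dual_generator => [a|a /HD[c ->]]; last by exists c; rewrite mulrA.
  by rewrite -mulrA => /reg/reg.
have [|x Ex] := dv e; first by rewrite ee; apply: valP.
have Hx : is_lmul l e x.
  by move=> a; rewrite Ex scalerA mulrC lE.
have [c ->] : exists c : sO W, t0 = c *: tmul KB (rcls B kap) l.
  move: t0; apply: tens_ind => [|a _ _ [c ->] [c' ->]|k l'].
  - by exists 0; rewrite scale0r.
  - by exists (a * c + c'); rewrite scalerDl scalerA.
  have [a Ea] := gen (qrep k).
  have Bt : t \in B W by apply/HB; exists 1; rewrite mulr1.
  have -> : l' = (ev OB l' (Subm Bt) : sO W) *: l.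
    apply: dual_unique => b; rewrite evZl.
    have -> : b = (ev OB l b : sO W) *: (Subm Bt : sub_qcoh B W).
      by apply: val_inj; rewrite -[LHS]lE /= /GRing.scale /= mulrC.
    rewrite !evZr /GRing.scale /=.
    have := lE (Subm Bt); rewrite /= => lt.
    have -> : (ev OB l (Subm Bt) : sO W) = 1.
      apply/eqP; rewrite -subr_eq0; apply/eqP/reg.
      by rewrite mulrBr lt mulr1 subrr.
    by rewrite mulr1 mulrC.
  rewrite -[k]rrepK Ea linearZ /=.
  exists ((ev OB l' (Subm Bt) : sO W) * a).
  by rewrite tmulZr tmulZl scalerA.
rewrite [s W _]linearZ (qf_quad (qrestr qt B)) (qf_quad rhoB); congr (_ *: _).
rewrite -[v]rrepK (Hs _ _ _ _ _ ee Hx) qrestr_cls; apply/esym/(hrhoB (d := d)).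
  move=> a b c' Ec; apply/eqP; rewrite -subr_eq0; apply/eqP.
  have reg2 z : t * t * z = 0 -> z = 0 by rewrite -mulrA => /reg/reg.
  apply: reg2; rewrite mulrBr dE Ec -!lE.
  by rewrite mulrACA subrr.
apply: hrho ext _ _ _ _ => a.
by rewrite -hqt Ex qf_quad -dE /GRing.scale /= expr2 mulrA [_ * (t * t)]mulrC.
Qed.

Lemma residual_second_summand (s : qhom KB Et|_B) : canonical_splitting s ->
  forall U (v : V|_B U) (t : KB U), qrestr qt B U v (s U t) = rhoB U v t.
Proof.
move=> Hs U v t; apply/eqP; rewrite -subr_eq0.
apply: (sub_local0 (N := zero_sub (OS S)|_B)) => x Ux.
have [W [h [f [e Wx sW [B1|[e0 [kap ext]]]]]]] := extension_near Ux.
  exists W, h, f; split=> //; move: (qres h _) => z; apply/eqP.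
  rewrite -[z]rrepK; apply/rcls0; rewrite -[qrep z]scale1r.
  exact: ideal_mul_mem.
exists W, h, f; split=> //; apply/eqP.
by rewrite qresB -!qf_res -hom_res (residual_splitting Hs sW ext) subrr.
Qed.
End Proposition.

Lemma inj_surj_bijective (T T' : Type) (f : T -> T') :
  injective f -> (forall y, exists x, f x = y) -> bijective f.
Proof.
move=> inj surj; exists (fun y => sval (cid (surj y))) => x; last by case: cid.
by apply: inj; case: cid.
Qed.


Theorem proposition2p12
  (* S is a scheme over a field of characteristic zero *)
  (kk : fieldType) (char0 : [pchar kk] =i pred0)
  (S : scheme) (structure_map : {rmorphism kk -> sO (topens S)})
  (r k : nat) (E V : qcoh S)
  (hE : vector_bundle r E) (hV : vector_bundle k V)
  (q : qfam V E (OS S))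
  (* D = 2B, where B is the divisor E of the text *)
  (D B : cartier S) (hD : is_double D B)
  (K : qsub E|_D) (hK : line_subbundle D r K) (hker : in_kernel K q)
  (* the sheaves O_S(B), O_S(D), K_B(B), V(D) *)
  (OB : OofD B) (OD : OofD D)
  (KB : qtensor (sub_qcoh K)|_B OB) (VD : qtensor V OD)
  (* the Hecke transform and the exact sequence 0 -> E -> Et -> K_B(B) -> 0 *)
  (Et : hecke r B K) (p : qhom Et KB) (hp : hecke_proj p)
  (qt : qfam V Et (OS S)) (hqt : hecke_qfam q qt)
  (* the residual family on D, and its restriction to B *)
  (rho : qfam VD|_D (sub_qcoh K) (OS S)|_D) (hrho : residual r q rho)
  (rhoB : qfam V|_B KB (OS S)|_B) (hrhoB : residual_restr rho rhoB) :
  exists (i1 : qhom (quot (sub_restr B K)) Et|_B) (i2 : qhom KB Et|_B),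
    (* (a) *)
    [/\ canonical_splitting i2
          /\ (forall s : qhom KB Et|_B, canonical_splitting s ->
                forall (U : aff S) (t : KB U), s U t = i2 U t),
        (forall (U : aff S) (t : KB U) (x : Et U), i2 U t = rcls B x -> p U x = t),
        (forall (U : aff S) (y : E U),
           i1 U (qcls (sub_restr B K) U (rcls B y)) = rcls B (hecke_j Et U y))
      & forall U : aff S,
          bijective (fun z : quot (sub_restr B K) U * KB U => i1 U z.1 + i2 U z.2)]
    /\
    (* (b) *)
    [/\ (forall (U : aff S) (v : V|_B U) (z : quot (sub_restr B K) U) (t : KB U),
           polar (qrestr qt B U) v (i1 U z) (i2 U t) = 0),
        (forall (U : aff S) (v : V|_B U) (y : E|_B U),
           qrestr qt B U v (i1 U (qcls (sub_restr B K) U y)) = qrestr q B U v y)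
      & forall (U : aff S) (v : V|_B U) (t : KB U),
           qrestr qt B U v (i2 U t) = rhoB U v t].
Proof.
have [i2 Hi2] := splitting_exists hD Et KB.
have [i1 Hi1] := quotient_map hD Et.
exists i1, i2; split; split.
- by split=> // s Hs U t; apply: (splitting_unique hD Hs Hi2).
- by move=> U t x; apply: (splitting_section hD hp Hi2).
- exact: Hi1.
- move=> U; apply: inj_surj_bijective => [[z t] [z' t'] /= Ezt|x].
    have [x [Ex Es _]] := splitting_lift hD hp Hi2 (t - t').
    have Ez : i1 U (z' - z) = i2 U (t - t').
      apply/eqP; rewrite !linearB subr_eq addrAC eq_sym subr_eq.
      by rewrite [_ + i1 U z]addrC Ezt addrC.
    have t0 : t - t' = 0.
      move: Ez; rewrite -[z' - z]qrepK -[qrep (z' - z)]rrepK Hi1 => /esym.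
      move=> /(splitting_section hD hp Hi2) <-.
      by apply/(hproj_ker hp); exists (qrep (qrep (z' - z))).
    move: Ez; rewrite t0 linear0 -[z' - z]qrepK -[qrep (z' - z)]rrepK Hi1.
    move=> /(j_ideal hD hp) H.
    have : qcls (sub_restr B K) U (rcls B (qrep (qrep (z' - z)))) = 0.
      by rewrite -[0](linear0 (qcls (sub_restr B K) U)); apply/qcls_eq; rewrite subr0.
    rewrite rrepK qrepK => /eqP; rewrite subr_eq0 => /eqP->.
    by move/eqP: t0; rewrite subr_eq0 => /eqP->.
  have [x' [Ex' Es _]] := splitting_lift hD hp Hi2 (p U (qrep x)).
  have [|y Ey] := (hproj_ker hp (qrep x - x')).1; first by rewrite linearB Ex' subrr.
  exists (qcls (sub_restr B K) U (rcls B y), p U (qrep x)) => /=.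
  by rewrite Hi1 Es -linearD -Ey subrK rrepK.
- exact: (splitting_orthogonal hD hqt hker hp Hi2 Hi1).
- move=> U v y; rewrite -[y]rrepK Hi1 -[v]rrepK !qrestr_cls.
  by rewrite hqt.
- exact: (residual_second_summand hE hD hK hqt hrho hrhoB Hi2).
Qed.
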